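(* Let $X_{H_\mu}$ be a generic one-parameter family of reversible analytic Hamiltonian systems such that at $\mu=0$ the system has a heteroclinic connection of type 1 or 2 as described in the context. Then there exists a sequence of parameter values $\mu_n$ accumulating to $\mu=0$ such that for $\mu=\mu_n$ the related system of the family has a homoclinic orbit of the general type of a saddle-center. The values $\mu_n$ all have the same sign.
   Context: Setting at $\mu=0$. $(M,\Omega)$ is a real analytic 4-dimensional symplectic manifold, $H=H_0:M\to\mathbb{R}$ is real analytic, $X_H$ is its Hamiltonian vector field, $V_c=\{H=c\}$. $L:M\to M$ is an analytic involution, anti-canonical ($L^*\Omega=-\Omega$), with $H\circ L=H$, so $DL(X_H)=-X_H\circ L$; $Fix(L)$ is an analytic two-dimensional submanifold. An orbit is symmetric if it is $L$-invariant. Heteroclinic connection. (i) $p$ is a symmetric equilibrium, $H(p)=0$, of saddle-center type (eigenvalues $\pm i\omega,\pm\lambda$, with $\omega,\lambda$ nonzero reals). (ii) $\gamma\subset V_0$ is a symmetric saddle periodic orbit with positive multipliers $\nu,\nu^{-1}$, $0<\nu<1$. (iii) $\Gamma_1\subset V_0$ is a non-symmetric heteroclinic orbit going, as $t$ increases, from $\gamma$ to $p$, and $\Gamma_2=L(\Gamma_1)$ goes from $p$ to $\gamma$. Coordinates near $p$ and types. In a neighborhood $U$ of $p$ there are analytic symplectic coordinates $(x_1,y_1,x_2,y_2)$, $\Omega=dx_1\wedge dy_1+dx_2\wedge dy_2$, with $H=h(\xi,\eta)=-\xi+\omega\eta+O(\xi^2+\eta^2)$, $\xi=x_1y_1$,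 $\eta=(x_2^2+y_2^2)/2$ (normalized so that $\lambda=-1$, $\omega>0$), with equations $\dot x_1=-h_\xi x_1$, $\dot y_1=h_\xi y_1$, $\dot x_2=-h_\eta y_2$, $\dot y_2=h_\eta x_2$, and $L$ is either $(x_1,y_1,x_2,y_2)\mapsto(y_1,x_1,-x_2,y_2)$ (type 1) or $(x_1,y_1,x_2,y_2)\mapsto(-y_1,-x_1,-x_2,y_2)$ (type 2). Family. $X_{H_\mu}$ is a family, smooth in $\mu$, of analytic Hamiltonian systems reversible with respect to $L$ ($H_\mu\circ L=H_\mu$), with $H_0=H$. For small $\mu$ there are a saddle-center $p_\mu$ continuing $p$ and a saddle periodic orbit $\gamma_\mu$ continuing $\gamma$ in the singular level $\{H_\mu=H_\mu(p_\mu)\}$; these and their stable and unstable manifolds depend smoothly on $\mu$. The coordinates near $p_\mu$ can be chosen smoothly depending on $\mu$, with $H_\mu=h_\mu(\xi,\eta)$ (up to the constant $H_\mu(p_\mu)$). Let $D_1\subset\{y_1=d\}$ and $D_2=L(D_1)$ be small disks in the singular level, with coordinates $(x_2,y_2)$, respectively $(\bar x_2,\bar y_2)$, transverse to the stable and the unstable separatrix of $p_\mu$ (those which at $\mu=0$ belong to $\Gamma_1$ and $\Gamma_2$); the point $(0,0)$ is the trace of the separatrix on each of them. Let $\Sigma(\mu)$ be the cross-section to $\gamma_\mu$ in the singular level through a point of $\gamma_\mu\cap Fix(L)$, cut out by an $L$-invariant three-dimensional cross-section, with analytic symplectic coordinates $(u,v)$, smooth in $\mu$, in which the Poincar\'e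 map is $S(\mu)(u,v)=(u/f_\mu(\zeta),\,vf_\mu(\zeta))$, $\zeta=uv$, $f_\mu(0)=\nu(\mu)$, $\nu(0)=\nu$, and $L$ acts as $(u,v)\mapsto(v,u)$; thus $u=0$ is the local trace of $W^s(\gamma_\mu)$ and $v=0$ is that of $W^u(\gamma_\mu)$. $\Gamma_2$ crosses $\Sigma(0)$ at $(0,v_+)$, $v_+>0$. Let $T_2(\mu):D_2\to\Sigma(\mu)$ be the map along the flow near $\Gamma_2$, and write $T_2(\mu)(0,0)=(a(\mu),\,v_++b(\mu))$, so $a(0)=b(0)=0$. Generic family: $a'(0)\ne0$, i.e. the trace of the unstable separatrix of the saddle-center crosses the trace of the stable manifold of the saddle periodic orbit transversely as $\mu$ varies through $0$. Homoclinic orbit of the general type: a homoclinic orbit of the saddle-center $p_\mu$ for which, in the analytic symplectic coordinates $(x_1,y_1,x_2,y_2)$ near $p_\mu$, smoothly depending on $\mu$, in which $H_\mu=H_\mu(p_\mu)+h_\mu(\xi,\eta)$ with $\xi=x_1y_1$, $\eta=(x_2^2+y_2^2)/2$, the linearization at the trace of the homoclinic orbit of the global map $D_2\to D_1$ along the homoclinic orbit (written in the coordinates $(\bar x_2,\bar y_2)$ and $(x_2,y_2)$) is a matrix different from a rotation matrix. *)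

(* Defs.v *)
From HB Require Import structures.
From mathcomp Require Import all_boot all_order all_algebra.
From mathcomp Require Import complex.
From mathcomp Require Import all_classical all_reals all_analysis.

Set Implicit Arguments.
Unset Strict Implicit.
Unset Printing Implicit Defensive.

Import Order.TTheory GRing.Theory Num.Theory numFieldNormedType.Exports.

Local Open Scope classical_set_scope.
Local Open Scope ring_scope.

(* Vectors are rows: the matrix J = jacobian f x of 'd f x acts by
   v |-> v *m J, and a matrix A of a bilinear form gives v *m A *m w^T. *)

Section Calculus.
Variable R : realType.

Definition vec2 (a b : R) : 'rV[R]_2 := \row_(i < 2) [:: a; b]`_i.
Definition vec4 (a b c d : R) : 'rV[R]_4 := \row_(i < 4) [:: a; b; c; d]`_i.

Definition cube (n : nat) (r : R) : set 'rV[R]_n :=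
  [set x | forall i, `|x 0 i| < r].

(* On an open set, having continuous iterated directional derivatives up to
   order k is being C^k (all the spaces below are finite-dimensional). *)
Fixpoint Ck (k : nat) (V W : normedModType R) (U : set V) (f : V -> W) : Prop :=
  (forall x, U x -> {for x, continuous f}) /\
  (if k is k'.+1 then
     forall v : V, (forall x, U x -> derivable f x v) /\
                   Ck k' U (fun x => 'D_v f x : W)
   else True).

Definition smooth_on (V W : normedModType R) (U : set V) (f : V -> W) : Prop :=
  forall k, Ck k U f.

(* The bound on the coefficients makes the power series absolutely convergent
   on the open cube of radius r, so the order of summation is immaterial. *)
Definition analytic_at (n : nat) (f : 'rV[R]_n -> R) (a : 'rV[R]_n) : Prop :=
  exists (c : {ffun 'I_n -> nat} -> R) (r C : R),
    [/\ 0 < r,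
        forall al, `|c al| * r ^+ (\sum_i al i)%N <= C &
        forall x, (cube r) (x - a) ->
          \sum_(al : {ffun 'I_n -> 'I_N})
             c [ffun i => al i : nat] * \prod_i (x 0 i - a 0 i) ^+ al i
          @[N --> \oo] --> f x].

Definition analytic_on (n : nat) (U : set 'rV[R]_n) (f : 'rV[R]_n -> R) : Prop :=
  forall a, U a -> analytic_at f a.

Definition analytic_map_on (n m : nat) (U : set 'rV[R]_n)
    (f : 'rV[R]_n -> 'rV[R]_m) : Prop :=
  forall j, analytic_on U (fun x => f x 0 j).

Definition grad (n : nat) (f : 'rV[R]_n -> R) (x : 'rV[R]_n) : 'rV[R]_n :=
  \row_(i < n) 'D_(delta_mx 0 i) f x.

(* du /\ dv, respectively dx1 /\ dy1 + dx2 /\ dy2 in the order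
   (x1, y1, x2, y2). *)
Definition std2 : 'M[R]_2 := \matrix_(i, j) ((i < j)%N%:R - (j < i)%N%:R).
Definition std4 : 'M[R]_4 := block_mx std2 0 0 std2.

Definition rotation_mx (A : 'M[R]_2) : Prop :=
  exists theta : R, A = \matrix_(i, j)
    (if i == j then cos theta else if (i < j)%N then - sin theta else sin theta).

End Calculus.

Section Manifold.
Variable R : realType.

(* cmap is meaningful on cdom, cinv on the image of cdom. *)
Record chart (M : topologicalType) := Chart {
  cdom : set M;
  cmap : M -> 'rV[R]_4;
  cinv : 'rV[R]_4 -> M }.

Definition cimg (M : topologicalType) (c : chart M) := cmap c @` cdom c.

Definition is_chart (M : topologicalType) (c : chart M) : Prop :=
  [/\ open (cdom c), open (cimg c),
      forall q, cdom c q -> cinv c (cmap c q) = q,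
      forall q, cdom c q -> {for q, continuous (cmap c)} &
      forall x, cimg c x -> {for x, continuous (cinv c)}].

Definition overlap (M : topologicalType) (c c' : chart M) : set 'rV[R]_4 :=
  cmap c @` (cdom c `&` cdom c').

Definition transition (M : topologicalType) (c c' : chart M) :=
  cmap c' \o cinv c.

Definition compatible (M : topologicalType) (c c' : chart M) : Prop :=
  analytic_map_on (overlap c c') (transition c c').

Record symplectic4 := Symplectic4 {
  carrier :> topologicalType;
  atlas : set (chart carrier);
  (* form c x is the matrix of the symplectic form in the chart c at x *)
  form : chart carrier -> 'rV[R]_4 -> 'M[R]_4;
  carrier_hausdorff : hausdorff_space carrier;
  carrier_countable : @second_countable carrier;
  atlas_chart : forall c, atlas c -> is_chart c;
  atlas_cover : forall q, exists2 c, atlas c & cdom c q;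
  atlas_compatible : forall c c', atlas c -> atlas c' -> compatible c c';
  form_analytic : forall c, atlas c ->
    forall i j, analytic_on (cimg c) (fun x => form c x i j);
  form_skew : forall c, atlas c -> forall x, cimg c x ->
    (form c x)^T = - form c x;
  form_nondegenerate : forall c, atlas c -> forall x, cimg c x ->
    form c x \in unitmx;
  form_closed : forall c, atlas c -> forall x, cimg c x -> forall i j k,
    grad (fun y => form c y j k) x 0 i + grad (fun y => form c y k i) x 0 j +
    grad (fun y => form c y i j) x 0 k = 0;
  form_transition : forall c c', atlas c -> atlas c' ->
    forall x, overlap c c' x ->
    let J := jacobian (transition c c') x in
    form c x = J *m form c' (transition c c' x) *m J^T }.

Variable M : symplectic4.

Definition analytic_chart (k : chart M) : Prop :=
  is_chart k /\ forall c, atlas c -> compatible c k /\ compatible k c.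

Definition darboux_chart (k : chart M) : Prop :=
  analytic_chart k /\
  forall c, atlas c -> forall x, overlap k c x ->
    let J := jacobian (transition k c) x in
    J *m form c (transition k c x) *m J^T = std4 R.

Definition analytic_fun_on (O : set M) (f : M -> R) : Prop :=
  forall c, atlas c -> analytic_on (cmap c @` (cdom c `&` O)) (f \o cinv c).

Definition analytic_into (n : nat) (U : set 'rV[R]_n) (F : 'rV[R]_n -> M) :=
  (forall x, U x -> {for x, continuous F}) /\
  forall c, atlas c -> analytic_map_on (U `&` F @^-1` cdom c) (cmap c \o F).

Definition smooth_into (V : normedModType R) (U : set V) (F : V -> M) : Prop :=
  (forall x, U x -> {for x, continuous F}) /\
  forall c, atlas c -> smooth_on (U `&` F @^-1` cdom c) (cmap c \o F).

Definition analytic_self_map (g : M -> M) : Prop :=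
  continuous g /\
  forall c, atlas c -> analytic_into (cimg c) (g \o cinv c).

Definition anticanonical (g : M -> M) : Prop :=
  forall c c', atlas c -> atlas c' ->
  forall q, cdom c q -> cdom c' (g q) ->
    let J := jacobian (cmap c' \o g \o cinv c) (cmap c q) in
    J *m form c' (cmap c' (g q)) *m J^T = - form c (cmap c q).

Definition fixed_set (g : M -> M) : set M := [set q | g q = q].

Definition submanifold2 (A : set M) : Prop :=
  forall q, A q -> exists k, [/\ analytic_chart k, cdom k q &
    forall q', cdom k q' -> (A q' <-> cmap k q' 0 2 = 0 /\ cmap k q' 0 3 = 0)].

(* The solution X of dH(v) = Omega(v, X) for all v, in the chart c.  In
   coordinates with form std4 this reads x' = - dH/dy, y' = dH/dx, so that for
   H = h(xi, eta) one gets x1' = - h_xi x1, y1' = h_xi y1, x2' = - h_eta y2,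
   y2' = h_eta x2. *)
Definition hamvec (H : M -> R) (c : chart M) (x : 'rV[R]_4) : 'rV[R]_4 :=
  grad (H \o cinv c) x *m (invmx (form c x))^T.

Definition solves_at (H : M -> R) (x : R -> M) (t : R) : Prop :=
  {for t, continuous x} /\
  forall c, atlas c -> cdom c (x t) ->
    is_derive t (1 : R) (cmap c \o x) (hamvec H c (cmap c (x t))).

Definition solution (H : M -> R) (x : R -> M) : Prop :=
  forall t, solves_at H x t.

Definition flows (H : M -> R) (q : M) (s : R) (q' : M) : Prop :=
  exists x : R -> M,
    [/\ x 0 = q, x s = q' & forall t, 0 <= t <= s -> solves_at H x t].

(* G is the map along the flow, with transit time tau, from the surface
   parametrized by P on A to the surface parametrized by Q. *)
Definition flow_map (H : M -> R) (A : set 'rV[R]_2) (P Q : 'rV[R]_2 -> M)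
    (G : 'rV[R]_2 -> 'rV[R]_2) (tau : 'rV[R]_2 -> R) : Prop :=
  forall w, A w ->
    [/\ 0 < tau w, {for w, continuous tau} & flows H (P w) (tau w) (Q (G w))].

Definition equilibrium (H : M -> R) (q : M) : Prop :=
  forall c, atlas c -> cdom c q -> hamvec H c (cmap c q) = 0.

(* The eigenvalues of the linearization are lam, - lam, i om, - i om. *)
Definition saddle_center (H : M -> R) (q : M) (lam om : R) : Prop :=
  [/\ equilibrium H q, lam != 0, om != 0 &
    forall c, atlas c -> cdom c q ->
      let A := map_mx (real_complex R) (jacobian (hamvec H c) (cmap c q)) in
      [/\ eigenvalue A (Complex lam 0), eigenvalue A (Complex (- lam) 0),
          eigenvalue A (Complex 0 om) & eigenvalue A (Complex 0 (- om))]].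

Definition symmetric_orbit (L : M -> M) (x : R -> M) : Prop :=
  L @` range x = range x.

Definition periodic_orbit (H : M -> R) (x : R -> M) (T : R) : Prop :=
  [/\ solution H x, 0 < T, forall t, x (t + T) = x t &
      forall t, 0 < t < T -> x t <> x 0].

Definition homoclinic_orbit (H : M -> R) (q : M) (x : R -> M) : Prop :=
  [/\ solution H x, exists t, x t <> q,
      x t @[t --> +oo] --> q & x t @[t --> -oo] --> q].

(* A three-dimensional analytic cross-section to the flow of H: a hypersurface
   to which the Hamiltonian vector field is nowhere tangent. *)
Definition cross_section (H : M -> R) (N : set M) : Prop :=
  exists (O : set M) (F : M -> R),
    [/\ open O, analytic_fun_on O F, N = O `&` [set q | F q = 0] &
      forall q, N q -> forall c, atlas c -> cdom c q ->
        hamvec H c (cmap c q) *m (grad (F \o cinv c) (cmap c q))^T != 0].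

Record ham_family := HamFamily {
  mu_max : R;                      (* the parameter range is `|mu| < mu_max *)
  ham : R -> M -> R;
  invol : M -> M }.

Record saddle_center_data := SaddleCenterData {
  pmu : R -> M;
  loc : R -> chart M;              (* (x1, y1, x2, y2) near pmu mu *)
  rho : R;                         (* the image of these charts is cube rho *)
  hnf : R -> 'rV[R]_2 -> R;        (* h_mu(xi, eta) *)
  om : R }.

Record disk_data := DiskData {
  dsec : R;                        (* D1 lies in y1 = dsec *)
  delta : R;                       (* (x2, y2) ranges over cube delta *)
  x1D : R -> 'rV[R]_2 -> R }.      (* the coordinate x1 on D1 *)

Record periodic_data := PeriodicData {
  gam : R -> R -> M;               (* gam mu t *)
  per : R -> R;
  rad : R;                         (* (u, v) ranges over cube rad *)
  sig : R -> 'rV[R]_2 -> M;        (* the point of Sigma(mu) at (u, v) *)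
  fnf : R -> R -> R;               (* f_mu(zeta) *)
  tauS : R -> 'rV[R]_2 -> R }.     (* return time of the Poincare map *)

Record connection_data := ConnectionData {
  Gam1 : R -> M;
  T2 : R -> 'rV[R]_2 -> 'rV[R]_2;
  tau2 : R -> 'rV[R]_2 -> R;
  vplus : R }.

Inductive connection_type := Type1 | Type2.

Definition inv_coord (ty : connection_type) (x : 'rV[R]_4) : 'rV[R]_4 :=
  match ty with
  | Type1 => vec4 (x 0 1) (x 0 0) (- x 0 2) (x 0 3)
  | Type2 => vec4 (- x 0 1) (- x 0 0) (- x 0 2) (x 0 3)
  end.

Definition xi_eta (x : 'rV[R]_4) : 'rV[R]_2 :=
  vec2 (x 0 0 * x 0 1) ((x 0 2 ^+ 2 + x 0 3 ^+ 2) / 2).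

Definition reversible_family (F : ham_family) : Prop :=
  let L := invol F in
  [/\ 0 < mu_max F,
      [/\ analytic_self_map L, (forall q, L (L q) = q), anticanonical L &
          submanifold2 (fixed_set L)],
      forall c, atlas c ->
        smooth_on [set z : R * 'rV[R]_4 | `|z.1| < mu_max F /\ cimg c z.2]
                  (fun z => ham F z.1 (cinv c z.2)) &
      forall mu, `|mu| < mu_max F ->
        analytic_fun_on setT (ham F mu) /\
        forall q, ham F mu (L q) = ham F mu q].

Record saddle_center_family (F : ham_family) (P : saddle_center_data)
    (ty : connection_type) : Prop := {
  scf_rho : 0 < rho P;
  scf_saddle_center : forall mu, `|mu| < mu_max F ->
    exists lam w, saddle_center (ham F mu) (pmu P mu) lam w;
  scf_symmetric : fixed_set (invol F) (pmu P 0);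
  scf_level : ham F 0 (pmu P 0) = 0;
  scf_chart : forall mu, `|mu| < mu_max F ->
    [/\ darboux_chart (loc P mu), cimg (loc P mu) = cube (rho P),
        cdom (loc P mu) (pmu P mu) & cmap (loc P mu) (pmu P mu) = 0];
  scf_chart_smooth :
    smooth_into [set z : R * 'rV[R]_4 | `|z.1| < mu_max F /\ cube (rho P) z.2]
                (fun z => cinv (loc P z.1) z.2);
  scf_hnf_analytic : forall mu, `|mu| < mu_max F ->
    analytic_on (cube (rho P ^+ 2)) (hnf P mu);
  scf_hnf_smooth :
    smooth_on [set z : R * 'rV[R]_2 | `|z.1| < mu_max F /\ cube (rho P ^+ 2) z.2]
              (fun z => hnf P z.1 z.2);
  scf_ham : forall mu x, `|mu| < mu_max F -> cube (rho P) x ->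
    ham F mu (cinv (loc P mu) x) =
    ham F mu (pmu P mu) + hnf P mu (xi_eta x);
  (* h_0 = - xi + om eta + O(xi^2 + eta^2) *)
  scf_om : 0 < om P;
  scf_grad : grad (hnf P 0) 0 = vec2 (-1) (om P);
  scf_invol : forall mu x, `|mu| < mu_max F -> cube (rho P) x ->
    invol F (cinv (loc P mu) x) = cinv (loc P mu) (inv_coord ty x) }.

(* The points of D1, and of D2 = L(D1), with given (x2, y2)-coordinates; L
   changes the sign of x2 and preserves y2. *)
Definition D1 (P : saddle_center_data) (D : disk_data) (mu : R)
    (w : 'rV[R]_2) : M :=
  cinv (loc P mu) (vec4 (x1D D mu w) (dsec D) (w 0 0) (w 0 1)).

Definition D2 (F : ham_family) (P : saddle_center_data) (D : disk_data) (mu : R)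
    (w : 'rV[R]_2) : M :=
  invol F (D1 P D mu (vec2 (- w 0 0) (w 0 1))).

Definition disk_family (F : ham_family) (P : saddle_center_data) (D : disk_data) :=
  [/\ dsec D != 0 /\ `|dsec D| < rho P,
      0 < delta D <= rho P,
      smooth_on [set z : R * 'rV[R]_2 | `|z.1| < mu_max F /\ cube (delta D) z.2]
                (fun z => x1D D z.1 z.2) &
      forall mu, `|mu| < mu_max F ->
        [/\ x1D D mu 0 = 0, analytic_on (cube (delta D)) (x1D D mu) &
            forall w, cube (delta D) w -> `|x1D D mu w| < rho P /\
              ham F mu (D1 P D mu w) = ham F mu (pmu P mu)]].

Definition poincare (C : periodic_data) (mu : R) (w : 'rV[R]_2) : 'rV[R]_2 :=
  let u := w 0 0 in let v := w 0 1 in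
  vec2 (u / fnf C mu (u * v)) (v * fnf C mu (u * v)).

Definition multiplier (C : periodic_data) (mu : R) : R := fnf C mu 0.

Definition poincare_dom (C : periodic_data) (mu : R) : set 'rV[R]_2 :=
  [set w | cube (rad C) w /\ cube (rad C) (poincare C mu w)].

Record saddle_periodic_family (F : ham_family) (P : saddle_center_data)
    (C : periodic_data) : Prop := {
  spf_periodic : forall mu, `|mu| < mu_max F ->
    periodic_orbit (ham F mu) (gam C mu) (per C mu);
  spf_level : forall mu t, `|mu| < mu_max F ->
    ham F mu (gam C mu t) = ham F mu (pmu P mu);
  spf_symmetric : symmetric_orbit (invol F) (gam C 0);
  spf_smooth : smooth_into [set z : R * R | `|z.1| < mu_max F]
                           (fun z => gam C z.1 z.2);
  spf_rad : 0 < rad C;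
  spf_base : forall mu, `|mu| < mu_max F ->
    sig C mu 0 = gam C mu 0 /\ fixed_set (invol F) (gam C mu 0);
  spf_section : forall mu, `|mu| < mu_max F ->
    exists N : set M, [/\ cross_section (ham F mu) N, invol F @` N = N &
      sig C mu @` cube (rad C) =
      N `&` [set q | ham F mu q = ham F mu (pmu P mu)]];
  spf_sig_analytic : forall mu, `|mu| < mu_max F ->
    analytic_into (cube (rad C)) (sig C mu);
  spf_sig_smooth :
    smooth_into [set z : R * 'rV[R]_2 | `|z.1| < mu_max F /\ cube (rad C) z.2]
                (fun z => sig C z.1 z.2);
  spf_sig_embedding : forall mu, `|mu| < mu_max F ->
    exists2 kappa : M -> 'rV[R]_2,
      forall w, cube (rad C) w -> kappa (sig C mu w) = w &
      {within sig C mu @` cube (rad C), continuous kappa};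
  spf_sig_symplectic : forall mu w, `|mu| < mu_max F -> cube (rad C) w ->
    forall c, atlas c -> cdom c (sig C mu w) ->
      let J := jacobian (cmap c \o sig C mu) w in
      J *m form c (cmap c (sig C mu w)) *m J^T = std2 R;
  spf_invol : forall mu w, `|mu| < mu_max F -> cube (rad C) w ->
    invol F (sig C mu w) = sig C mu (vec2 (w 0 1) (w 0 0));
  spf_fnf_pos : forall mu zeta, `|mu| < mu_max F -> `|zeta| < rad C ^+ 2 ->
    0 < fnf C mu zeta;
  spf_fnf_analytic : forall mu, `|mu| < mu_max F ->
    analytic_on (cube (rad C ^+ 2)) (fun z : 'rV[R]_1 => fnf C mu (z 0 0));
  spf_fnf_smooth :
    smooth_on [set z : R * R | `|z.1| < mu_max F /\ `|z.2| < rad C ^+ 2]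
              (fun z => fnf C z.1 z.2);
  spf_poincare : forall mu, `|mu| < mu_max F ->
    flow_map (ham F mu) (poincare_dom C mu) (sig C mu) (sig C mu)
             (poincare C mu) (tauS C mu);
  spf_return_time : forall mu, `|mu| < mu_max F -> tauS C mu 0 = per C mu;
  spf_tau_smooth :
    smooth_on [set z : R * 'rV[R]_2 | `|z.1| < mu_max F /\ poincare_dom C z.1 z.2]
              (fun z => tauS C z.1 z.2);
  spf_saddle : forall mu, `|mu| < mu_max F ->
    [/\ 0 < multiplier C mu < 1,
        eigenvalue (jacobian (poincare C mu) 0) (multiplier C mu) &
        eigenvalue (jacobian (poincare C mu) 0) (multiplier C mu)^-1] }.

(* A smooth family of diffeomorphisms of cube r onto open subsets of R^2, the
   inverses being smooth in the parameter too. *)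
Definition diffeo_family (e r : R) (f : R -> 'rV[R]_2 -> 'rV[R]_2) : Prop :=
  let dom := [set z : R * 'rV[R]_2 | `|z.1| < e /\ cube r z.2] in
  let im := [set z : R * 'rV[R]_2 | `|z.1| < e /\ (f z.1 @` cube r) z.2] in
  [/\ smooth_on dom (fun z => f z.1 z.2), open im &
      exists g : R -> 'rV[R]_2 -> 'rV[R]_2,
        smooth_on im (fun z => g z.1 z.2) /\
        forall z, dom z -> g z.1 (f z.1 z.2) = z.2].

Definition Gam2 (F : ham_family) (K : connection_data) (t : R) : M :=
  invol F (Gam1 K (- t)).

Record heteroclinic_connection (F : ham_family) (P : saddle_center_data)
    (D : disk_data) (C : periodic_data) (K : connection_data) : Prop := {
  hc_solution : solution (ham F 0) (Gam1 K);
  hc_level : forall t, ham F 0 (Gam1 K t) = 0;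
  hc_nonsymmetric : ~ symmetric_orbit (invol F) (Gam1 K);
  hc_to_p : Gam1 K t @[t --> +oo] --> pmu P 0;
  hc_from_gam : forall O : set M, open O -> range (gam C 0) `<=` O ->
    \forall t \near -oo, O (Gam1 K t);
  hc_vplus : 0 < vplus K < rad C;
  hc_crossing : exists t,
    Gam2 F K t = D2 F P D 0 0 /\
    Gam2 F K (t + tau2 K 0 0) = sig C 0 (vec2 0 (vplus K));
  hc_T2_base : T2 K 0 0 = vec2 0 (vplus K);
  hc_T2_range : forall mu w, `|mu| < mu_max F -> cube (delta D) w ->
    cube (rad C) (T2 K mu w);
  hc_T2_analytic : forall mu, `|mu| < mu_max F ->
    analytic_map_on (cube (delta D)) (T2 K mu);
  hc_T2_diffeo : diffeo_family (mu_max F) (delta D) (T2 K);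
  hc_T2_flow : forall mu, `|mu| < mu_max F ->
    flow_map (ham F mu) (cube (delta D)) (D2 F P D mu) (sig C mu)
             (T2 K mu) (tau2 K mu);
  hc_tau2_smooth :
    smooth_on [set z : R * 'rV[R]_2 | `|z.1| < mu_max F /\ cube (delta D) z.2]
              (fun z => tau2 K z.1 z.2) }.

(* T2(mu)(0, 0) = (a mu, vplus + b mu) *)
Definition a_coord (K : connection_data) (mu : R) : R := T2 K mu 0 0 0.

Definition generic_family (K : connection_data) : Prop :=
  derive1 (a_coord K) 0 != 0.

(* G is the global map D2 -> D1 along the orbit x, which leaves D2 at time t2
   and reaches D1 at time t1; prescribing tau 0 selects the branch of the map
   that follows x. *)
Definition general_type_homoclinic (F : ham_family) (P : saddle_center_data)
    (D : disk_data) (mu : R) (x : R -> M) : Prop :=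
  homoclinic_orbit (ham F mu) (pmu P mu) x /\
  exists t2 t1 : R, [/\ t2 < t1, x t2 = D2 F P D mu 0, x t1 = D1 P D mu 0 &
    exists (r : R) (G : 'rV[R]_2 -> 'rV[R]_2) (tau : 'rV[R]_2 -> R),
      [/\ 0 < r <= delta D,
          flow_map (ham F mu) (cube r) (D2 F P D mu) (D1 P D mu) G tau,
          forall w, cube r w -> cube (delta D) (G w),
          G 0 = 0 /\ tau 0 = t1 - t2 &
          differentiable G (0 : 'rV[R]_2) /\
          ~ rotation_mx (jacobian G 0)]].

End Manifold.

(* Main.v *)
From HB Require Import structures.
Require Import Defs.
From mathcomp Require Import all_boot all_order all_algebra.
From mathcomp Require Import all_classical all_reals all_analysis.
From mathcomp Require Import ring lra.
Import Order.TTheory GRing.Theory Num.Theory numFieldNormedType.Exports.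
Local Open Scope classical_set_scope.
Local Open Scope ring_scope.

(** The homoclinic orbits that are found are symmetric, and they are produced by
    one scalar equation. Let [(a, v)] be the trace on the section of the periodic
    orbit of the unstable separatrix of the saddle-center; [a] vanishes at the
    parameter value 0, where [v = vplus > 0]. By reversibility the trace of the
    stable separatrix is [(v, a)]. The Poincare map in normal form preserves
    [zeta = u v], so that its [n]-th iterate carries [(a, v)] to
    [(a / phi ^ n, v phi ^ n)], where [phi = f (a v)] is close to the multiplier
    [nu < 1]. Hence the two separatrices are joined after [n] turns as soon as
    [a = v phi ^ n]. On the side of 0 on which [a > 0] (there is one because
    [a' (0) <> 0]), the difference [a - v phi ^ n] changes sign between 0 and any
    given small parameter value once [n] is large, and the intermediate value
    theorem yields a root ([general_type_near]).

    At such a root, the orbit follows the explicit unstable separatrix near the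
    saddle-center ([unstable_separatrix]), the passage [T2] to the section, the [n]
    turns around the periodic orbit, and then the mirror images of the passage and
    of the separatrix, run backwards ([symmetric_homoclinic],
    [general_type_of_root]). It is obtained by glueing solutions that agree at a
    point. That the involution reverses the flow ([solves_reversed]) and that
    the explicit curve in a Darboux chart is a solution in all charts
    ([solves_darboux]) are consequences of the chain rule, hence of the
    differentiability of analytic maps ([analytic_at_differentiable]).

    The linearization is not a rotation because the turns around the periodic
    orbit expand: the derivative of [u / f (u v) ^ n] in [u] is
    [(1 - n zeta f' / f) / f ^ n], where [n zeta] is of the order of [n nu ^ n] and
    tends to 0, while [f ^ (- n)] is unbounded ([blowup_ineq]). If the linearized
    global map were a rotation, this derivative would be bounded by the first
    derivatives of [T2] and of its inverse, which are bounded near the parameter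
    value 0 ([rotation_bound]). *)

Set Implicit Arguments.
Unset Strict Implicit.
Unset Printing Implicit Defensive.

(** * Differentiability of analytic functions *)

Section Analysis.
Variable R : realType.

Lemma coord_ler_norm (n : nat) (x : 'rV[R]_n) i : `|x 0 i| <= `|x|.
Proof.
rewrite [leRHS]/Num.Def.normr/= mx_normrE.
by apply: le_trans (le_bigmax _ _ (0, i)).
Qed.

Lemma norm_rV_le (n : nat) (x : 'rV[R]_n) (e : R) :
  0 <= e -> (forall i, `|x 0 i| <= e) -> `|x| <= e.
Proof.
move=> e0 h; rewrite [leLHS]/Num.Def.normr/= mx_normrE bigmax_le//= => -[i j] _.
by rewrite (ord1 i) h.
Qed.

(** The differential is a choice operator: exhibiting a continuous linear map
    with an [o(h)] error is what pins it down. *)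
Lemma differentiable_of_bound (V W : normedModType R) (f : V -> W)
    (l : {linear V -> W}) (x : V) : continuous l ->
  (forall e, 0 < e -> \forall h \near (0 : V),
     `|f (h + x) - f x - l h| <= e * `|h|) ->
  differentiable f x.
Proof.
move=> lc lb.
have key : f \o shift x = cst (f x) + l +o_ 0 id.
  apply/eqaddoP => e e0; near=> h.
  have : `|f (h + x) - f x - l h| <= e * `|h| by near: h; exact: lb.
  by rewrite /= opprD addrA.
apply/diff_locallyP; rewrite (diff_unique lc key); split => //.
Unshelve. all: by end_near. Qed.

Section RowForm.
Variables (n : nat) (c : 'I_n -> R).
Definition row_form (h : 'rV[R]_n) : R := \sum_i c i * h 0 i.
Fact row_form_linear : linear row_form.
Proof.
move=> k u v; rewrite /row_form scaler_sumr -big_split /=.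
by apply: eq_bigr => i _; rewrite !mxE mulrDr mulrCA.
Qed.
HB.instance Definition _ :=
  GRing.isLinear.Build R 'rV[R]_n R _ row_form row_form_linear.
Lemma row_form_continuous : continuous row_form.
Proof.
suff h s (x : 'rV[R]_n) :
    \sum_(i <- s) c i * h 0 i @[h --> x] --> \sum_(i <- s) c i * x 0 i.
  by move=> x; exact: h.
elim: s => [|i s IHs].
  under eq_fun do rewrite big_nil.
  by rewrite big_nil; exact: cvg_cst.
under eq_fun do rewrite big_cons.
rewrite big_cons; apply: cvgD => //.
by apply: cvgM; [exact: cvg_cst|exact: coord_continuous].
Qed.
End RowForm.

Section Analytic.
Variables (n : nat) (c : {ffun 'I_n -> nat} -> R) (r C : R).
Hypotheses (r0 : 0 < r) (cC : forall al, `|c al| * r ^+ (\sum_i al i)%N <= C).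

Let mono N (al : {ffun 'I_n -> 'I_N}) (h : 'rV[R]_n) : R :=
  c [ffun i => al i : nat] * \prod_i h 0 i ^+ al i.
Let C_ge0 : 0 <= C.
Proof. by apply: le_trans (cC [ffun => 0%N]); rewrite mulr_ge0// exprn_ge0// ltW. Qed.

Let deg N (al : {ffun 'I_n -> 'I_N}) : nat := (\sum_i al i)%N.

(** Summing over all multi-indices factors into [n] geometric series of ratio
    one half, each with partial sums below 2. *)
Lemma sum_half_deg N : \sum_(al : {ffun 'I_n -> 'I_N}) (2^-1 : R) ^+ deg al <= 2 ^+ n.
Proof.
have -> : \sum_(al : {ffun 'I_n -> 'I_N}) (2^-1 : R) ^+ deg al =
   \sum_(al : {ffun 'I_n -> 'I_N}) \prod_i (2^-1 : R) ^+ al i.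
  by apply: eq_bigr => al _; rewrite /deg (big_morph _ (exprD _) (expr0 _)).
rewrite -(bigA_distr_bigA (fun (i : 'I_n) (j : 'I_N) => (2^-1 : R) ^+ j)).
rewrite prodr_const card_ord lerXn2r ?nnegrE ?sumr_ge0//.
have := @subrXX R 1 2^-1 N.
rewrite expr1n (_ : 1 - 2^-1 = 2^-1 :> R); last by lra.
rewrite (eq_bigr (fun i : 'I_N => (2^-1 : R) ^+ i)); last first.
  by move=> i _; rewrite expr1n mul1r.
set S := \sum_(i < N) _ => e.
have : 0 <= (2^-1 : R) ^+ N by rewrite exprn_ge0.
lra.
Qed.

(** With [q = |h| / r <= 1/2] a monomial of degree [m >= 2] is at most [C q ^ m],
    and [q ^ m = q ^ 2 q ^ (m - 2) <= q ^ 2 (1/2) ^ (m - 2)]: the quadratic factor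
    is kept and what remains is summable. *)
Lemma mono_tail N (al : {ffun 'I_n -> 'I_N}) (h : 'rV[R]_n) : (2 <= deg al)%N ->
  `|h| <= r / 2 -> `|mono al h| <= 4 * C * (`|h| / r) ^+ 2 * 2^-1 ^+ deg al.
Proof.
move=> d2 hr; rewrite /mono normrM.
have q0 : 0 <= `|h| / r by rewrite divr_ge0// ltW.
have h1 : `|\prod_i h 0 i ^+ al i| <= `|h| ^+ deg al.
  rewrite normr_prod /deg (big_morph _ (exprD _) (expr0 _)).
  by apply: ler_prod => i _; rewrite normr_ge0 normrX lerXn2r ?nnegrE// coord_ler_norm.
apply: (@le_trans _ _ (C * (`|h| / r) ^+ deg al)).
  apply: le_trans (_ : `|c [ffun i => al i : nat]| * `|h| ^+ deg al <= _).
    by rewrite ler_wpM2l.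
  rewrite expr_div_n mulrCA [leRHS]mulrC.
  rewrite ler_wpM2r ?exprn_ge0// ler_pdivlMr ?exprn_gt0//.
  apply: le_trans (cC [ffun i => al i : nat]).
  by rewrite /deg; under [in leRHS]eq_bigr do rewrite ffunE.
have eX (x : R) : x ^+ deg al = x ^+ (deg al - 2) * x ^+ 2.
  by rewrite -exprD subnK.
rewrite !eX.
have -> : 4 * C * (`|h| / r) ^+ 2 * (2^-1 ^+ (deg al - 2) * 2^-1 ^+ 2) =
    C * (2^-1 ^+ (deg al - 2) * (`|h| / r) ^+ 2) :> R.
  by set X := 2^-1 ^+ (_ - _); set Y := _ ^+ 2; field.
rewrite ler_wpM2l// ler_wpM2r ?exprn_ge0//.
by rewrite lerXn2r ?nnegrE// ler_pdivrMr// mulrC.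
Qed.

(** A uniform second-order Taylor estimate for the partial sums: all terms but
    those of degree 0 and 1 add up to [O(|h| ^ 2)], with a constant independent
    of the number of terms, so it passes to the limit. *)
Lemma partial_sum_bound N (h : 'rV[R]_n) : `|h| <= r / 2 ->
  `|\sum_(al : {ffun 'I_n -> 'I_N.+2}) mono al h - c [ffun => 0%N] -
     row_form (fun i => c [ffun j => (j == i) : nat]) h|
    <= 4 * C * 2 ^+ n * (`|h| / r) ^+ 2.
Proof.
move=> hr.
pose d1 (i : 'I_n) : {ffun 'I_n -> 'I_N.+2} :=
  [ffun j => if j == i then Ordinal (isT : (1 < N.+2)%N) else ord0].
have d1E i j : d1 i j = (j == i) :> nat by rewrite /d1 ffunE; case: (j == i).
have d1_inj : injective d1.
  move=> i j /ffunP/(_ i)/(congr1 val) /=.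
  by rewrite !d1E eqxx; case: (i =P j).
pose d0 : {ffun 'I_n -> 'I_N.+2} := [ffun => ord0].
have hd0 al : (deg al == 0%N) = (al == d0).
  rewrite /deg sum_nat_eq0; apply/forallP/eqP => [h0|-> i]; last first.
    by rewrite !ffunE.
  by apply/ffunP => i; apply/val_inj/eqP; have := h0 i; rewrite !ffunE.
have hd1 al : (deg al == 1%N) = (al \in [set d1 i | i in 'I_n]%SET).
  apply/sum_nat_eq1/imsetP => -[i]; last first.
    move=> _ ->; exists i; split; rewrite ?d1E ?eqxx// => j /negbTE ji _.
    by rewrite d1E ji.
  move=> [_ ai hi]; exists i => //; apply/ffunP => j; apply/val_inj => /=.
  rewrite d1E; case: (eqVneq j i) => [->//|ji]; exact: hi.
rewrite (bigID (fun al => (1 < deg al)%N)) /=.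
rewrite [X in _ + X - _ - _](bigID (fun al => deg al == 0%N)) /=.
rewrite [X in _ + (X + _)](eq_bigl (pred1 d0)) ; last first.
  move=> al /=; rewrite -hd0; case: (deg al) => [|k] //=.
  exact: andbF.
rewrite big_pred1_eq.
rewrite [X in _ + (_ + X)](eq_bigl (fun al => al \in [set d1 i | i in 'I_n]%SET));
  last first.
  move=> al; rewrite -hd1 -leqNgt; by case: (deg al) => [|[|k]].
rewrite big_imset /=; last by move=> i j _ _; exact: d1_inj.
have -> : mono d0 h = c [ffun => 0%N].
  rewrite /mono big1 ?mulr1; last by move=> i _; rewrite ffunE expr0.
  by congr c; apply/ffunP => i; rewrite !ffunE.
have -> : \sum_(i in 'I_n) mono (d1 i) h =
    row_form (fun i => c [ffun j => (j == i) : nat]) h.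
  apply: eq_bigr => i _; rewrite /mono; congr (_ * _).
    by congr c; apply/ffunP => j; rewrite !ffunE; case: (j == i).
  rewrite (bigD1 i) //= d1E eqxx expr1 big1 ?mulr1// => j /negbTE ji.
  by rewrite d1E ji expr0.
set X := \sum_(al | _) _; set Y := row_form _ _.
have -> : X + (c [ffun=> 0%N] + Y) - c [ffun=> 0%N] - Y = X by ring.
apply: le_trans (ler_norm_sum _ _ _) _.
have K0 : 0 <= 4 * C * (`|h| / r) ^+ 2.
  by rewrite mulr_ge0 ?exprn_ge0 ?divr_ge0 ?mulr_ge0// ltW.
apply: le_trans (_ : \sum_(al : {ffun 'I_n -> 'I_N.+2})
    4 * C * (`|h| / r) ^+ 2 * 2^-1 ^+ deg al <= _).
  rewrite [leRHS](bigID (fun al => (1 < deg al)%N)) /=.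
  rewrite -[leLHS]addr0 lerD ?sumr_ge0//; last first.
    by move=> al _; rewrite mulr_ge0// exprn_ge0.
  by apply: ler_sum => al h2; exact: mono_tail.
rewrite -mulr_sumr [leRHS]mulrAC ler_wpM2l//; exact: sum_half_deg.
Qed.
End Analytic.

Lemma analytic_at_differentiable (n : nat) (f : 'rV[R]_n -> R) a :
  analytic_at f a -> differentiable f a.
Proof.
move=> [c [r [C [r0 cC fE]]]].
pose l := row_form (fun i => c [ffun j => (j == i) : nat]).
pose K := 4 * C * 2 ^+ n.
have C0 : 0 <= C.
  by apply: le_trans (cC [ffun => 0%N]); rewrite mulr_ge0// exprn_ge0// ltW.
have K0 : 0 <= K by rewrite /K mulr_ge0// ?mulr_ge0// exprn_ge0.
have key h : `|h| <= r / 2 ->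
    `|f (h + a) - c [ffun => 0%N] - l h| <= K * (`|h| / r) ^+ 2.
  move=> hr; have xr : (cube r) ((h + a) - a).
    move=> i; rewrite addrK; apply: le_lt_trans (coord_ler_norm _ _) _.
    by apply: le_lt_trans hr _; lra.
  have := fE _ xr.
  under eq_fun => N do under eq_bigr => al _ do
     under eq_bigr => i _ do rewrite (_ : (h + a) 0 i - a 0 i = h 0 i) ?mxE ?addrK//.
  move=> cv.
  (* the bound needs degree 1 to be present, hence the shift by 2 *)
  have cv2 : `|\sum_(al : {ffun 'I_n -> 'I_N.+2})
             c [ffun i => al i : nat] * (\prod_i h 0 i ^+ al i)
             - c [ffun => 0%N] - l h| @[N --> \oo] -->
       `|f (h + a) - c [ffun => 0%N] - l h|.
    apply: cvg_norm; apply: cvgB; last exact: cvg_cst.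
    apply: cvgB; last exact: cvg_cst.
    by rewrite -(cvg_shiftn 2) in cv; under eq_fun do rewrite -addn2.
  apply: (cvgr_to_le cv2); near=> N; exact: partial_sum_bound.
have fa : f a = c [ffun => 0%N].
  have l0 : l 0 = 0 by exact: linear0.
  have := key 0; rewrite normr0 mul0r expr0n mulr0 normr_le0 add0r.
  rewrite l0 subr0 subr_eq0 => /(_ _)/eqP; apply.
  by rewrite divr_ge0// ltW.
apply: (@differentiable_of_bound _ _ f l); first exact: row_form_continuous.
move=> e e0.
have K1 : 0 < K + 1 by rewrite ltr_wpDl.
near=> h.
rewrite fa; apply: le_trans (key _ _) _.
  near: h; apply: (@nbhs0_le R 'rV[R]_n); exact: divr_gt0.
have -> : K * (`|h| / r) ^+ 2 = K * `|h| / r ^+ 2 * `|h|.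
  by field; rewrite gt_eqF.
rewrite ler_wpM2r// ler_pdivrMr ?exprn_gt0//.
have : `|h| <= e * r ^+ 2 / (K + 1).
  near: h; apply: (@nbhs0_le R 'rV[R]_n); apply: divr_gt0 => //.
  by apply: mulr_gt0 => //; exact: exprn_gt0.
rewrite ler_pdivlMr// mulrC; apply: le_trans.
by rewrite ler_wpM2r// lerDl.
Unshelve. all: by end_near. Qed.

Lemma differentiable_row (V : normedModType R) (m : nat) (f : V -> 'rV[R]_m) x :
  (forall j, differentiable (fun y => f y 0 j) x) -> differentiable f x.
Proof.
move=> df.
have -> : f = \sum_(j < m) (fun y => f y 0 j *: (delta_mx 0 j : 'rV[R]_m)).
  apply/funext => y; rewrite fct_sumE /=; apply/rowP => k.
  rewrite summxE (bigD1 k)//= !mxE !eqxx mulr1 big1 ?addr0// => j jk.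
  by rewrite !mxE eqxx eq_sym (negbTE jk) mulr0.
by apply: differentiable_sum => j; apply: differentiableZl.
Qed.

Lemma analytic_map_differentiable (n m : nat) U (f : 'rV[R]_n -> 'rV[R]_m) a :
  analytic_map_on U f -> U a -> differentiable f a.
Proof.
by move=> fa Ua; apply: differentiable_row => j; exact/analytic_at_differentiable/fa.
Qed.

End Analysis.

(** * Differentiability from continuous partial derivatives *)

Section C1.
Variable R : realType.

Lemma is_derive_line (V W : normedModType R) (f : V -> W) (z v : V) (s : R) :
  derivable f (z + s *: v) v ->
  is_derive s (1 : R) (fun t => f (z + t *: v)) ('D_v f (z + s *: v)).
Proof.
move=> df.
have e : (fun h : R => h^-1 *: (((fun t => f (z + t *: v)) \o shift s) (h *: (1 : R))
      - f (z + s *: v))) =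
    (fun h : R => h^-1 *: ((f \o shift (z + s *: v)) (h *: v) - f (z + s *: v))).
  apply/funext => h /=; congr (_ *: (f _ - _)).
  by rewrite [h *: 1]mulr1 scalerDl addrCA addrA.
by apply: DeriveDef; rewrite ?/derivable ?/derive e.
Qed.

Lemma mean_value_bound (g : R -> R) (c e : R) :
  (forall t : R, 0 <= t <= 1 ->
     exists2 d : R, is_derive t (1 : R) g d & `|d - c| <= e) ->
  `|g 1 - g 0 - c| <= e.
Proof.
move=> H.
have D (t : R) : t \in `[0, 1] -> is_derive t (1 : R) g ('D_1 g t).
  by rewrite in_itv /= => /H[d [dg _] _]; exact: (DeriveDef dg erefl).
have gc : {within `[0, 1], continuous g}.
  by apply: derivable_within_continuous => t /D[].
have D' (t : R) : t \in `]0, 1[ -> is_derive t (1 : R) g ('D_1 g t).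
  by rewrite in_itv /= => /andP[t0 t1]; apply: D; rewrite in_itv /= !ltW.
have [t t01 ->] := MVT_segment ler01 D' gc.
rewrite subr0 mulr1.
by move: t01; rewrite in_itv /= => /H[d dg]; rewrite (@derive_val _ _ _ _ _ _ _ dg).
Qed.

(** The increment from [x] to [x + h] is decomposed into steps parallel to the
    axes; on the step along the axis [k] the mean value inequality compares the
    increment with [h_k] times the partial derivative at [x]. *)
Lemma differentiable_of_partials (n : nat) (f : 'rV[R]_n -> R) (x : 'rV[R]_n) :
  (forall i, \forall y \near x, derivable f y (delta_mx 0 i)) ->
  (forall i, {for x, continuous ('D_(delta_mx 0 i) f)}) ->
  differentiable f x.
Proof.
move=> df cf.
pose D i := 'D_(delta_mx 0 i) f.
apply: (@differentiable_of_bound _ _ _ f (row_form (fun i => D i x))).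
  exact: row_form_continuous.
move=> e e0.
pose e' := e / n.+1%:R.
have e'0 : 0 < e' by rewrite divr_gt0.
have : \forall y \near x, forall i,
    derivable f y (delta_mx 0 i) /\ `|D i x - D i y| <= e'.
  apply: (@filter_forall _ _ _ (nbhs x)) => i; near=> y; split.
    by near: y; exact: df.
  by near: y; have /cvgrPdist_le := cf i; apply.
case/nbhs_ballP => d /= d0 dH; near=> h.
have hd : `|h| < d by near: h; exact: (@nbhs0_lt R 'rV[R]_n).
(* the corner reached after k steps parallel to the axes *)
pose z (k : nat) : 'rV[R]_n := x + \row_i (if (i < k)%N then h 0 i else 0).
have z0 : z 0%N = x by apply/rowP => i; rewrite !mxE addr0.
have zn : z n = h + x by apply/rowP => i; rewrite !mxE ltn_ord addrC.
have zS (k : 'I_n) : z k.+1 = z k + h 0 k *: delta_mx 0 k.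
  apply/rowP => i; rewrite !mxE eqxx -addrA; congr (_ + _).
  rewrite ltnS leq_eqVlt; case: (ltngtP i k) => [ik|ki|/val_inj ->] /=.
  - rewrite (_ : i == k = false) ?mulr0 ?addr0//.
    by apply/eqP => j; rewrite j ltnn in ik.
  - rewrite (_ : i == k = false) ?mulr0 ?addr0//.
    by apply/eqP => j; rewrite j ltnn in ki.
  - by rewrite !eqxx /= mulr1 add0r.
have -> : f (h + x) - f x = \sum_(k < n) (f (z k.+1) - f (z k)).
  by rewrite -(big_mkord xpredT (fun k => f (z k.+1) - f (z k))) telescope_sumr// z0 zn.
rewrite /row_form -sumrB.
apply: le_trans (ler_norm_sum _ _ _) _.
apply: (@le_trans _ _ (\sum_(k < n) e' * `|h|)); last first.
  rewrite sumr_const card_ord -mulr_natl mulrA ler_wpM2r// /e' mulrCA.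
  apply: ler_piMr; first exact: ltW.
  by rewrite ler_pdivrMr// mul1r ler_nat.
apply: ler_sum => k _.
apply: le_trans (_ : e' * `|h 0 k| <= _); last first.
  by rewrite ler_wpM2l ?coord_ler_norm// ltW.
pose g t := f (z k + t *: (h 0 k *: delta_mx 0 k)).
have -> : f (z k.+1) = g 1 by rewrite /g scale1r zS.
have -> : f (z k) = g 0 by rewrite /g scale0r addr0.
apply: mean_value_bound => t /andP[t0 t1].
have [dft Dft] : derivable f (z k + (t * h 0 k) *: delta_mx 0 k) (delta_mx 0 k) /\
     `|D k x - D k (z k + (t * h 0 k) *: delta_mx 0 k)| <= e'.
  apply: dH; rewrite -ball_normE /= distrC.
  apply: le_lt_trans hd; apply: norm_rV_le => // i.
  rewrite /z !mxE eqxx /= -addrA addrAC subrr add0r.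
  case: (eqVneq i k) => [->|ik]; rewrite ?ltnn /=.
    rewrite add0r mulr1 normrM.
    apply: le_trans (coord_ler_norm h k); rewrite ler_piMl//.
    by rewrite ger0_norm.
  rewrite mulr0 addr0; case: ifP => _; rewrite ?normr0//; exact: coord_ler_norm.
exists (h 0 k * D k (z k + (t * h 0 k) *: delta_mx 0 k)); last first.
  rewrite (mulrC (D k x)) -mulrBr normrM mulrC ler_wpM2r// distrC//.
have -> : g = (fun s => f (z k + s *: delta_mx 0 k)) \o (fun t => t * h 0 k).
  by apply/funext => s; rewrite /g /= scalerA.
have dl : is_derive t (1 : R) (fun s : R => s * h 0 k) (h 0 k).
  have -> : (fun s : R => s * h 0 k) = h 0 k *: id.
    by apply/funext => s; rewrite mulrC.
  by apply: is_derive_eq; rewrite [_ *: 1]mulr1.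
have dg := @is_derive_line _ _ f (z k) (delta_mx 0 k) (t * h 0 k) dft.
by rewrite mulrC; exact: (@is_derive1_comp _ _ _ t _ _ dg dl).
Unshelve. all: by end_near. Qed.
End C1.

(** * Derivatives along curves and change of coordinates *)

Section Curves.
Variable R : realType.

Lemma is_derive_cvgP (V W : normedModType R) (f : V -> W) (x v : V) (d : W) :
  is_derive x v f d <->
  (h^-1 *: (f (h *: v + x) - f x)) @[h --> 0^'] --> d.
Proof.
split=> [[/cvg_ex[l fl] <-]|fd].
  by rewrite /derive (cvg_lim _ fl).
apply: DeriveDef; first by apply/cvg_ex; exists d.
exact: (cvg_lim _ fd).
Qed.

Lemma is_derive_comp (V W : normedModType R) (f : V -> W) (g : R -> V) (t : R) (X : V) :
  differentiable f (g t) -> is_derive t (1 : R) g X ->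
  is_derive t (1 : R) (f \o g) ('d f (g t) X).
Proof.
move=> df [/derivable1_diffP dg dgX].
have dfg : differentiable (f \o g) t by exact: differentiable_comp.
apply: DeriveDef; first exact/derivable1_diffP.
by rewrite deriveE// diff_comp//= -dgX deriveE.
Qed.

Lemma is_derive_reparam (V : normedModType R) (g : R -> V) (p : R -> R)
    (t b : R) (X : V) :
  is_derive (p t) (1 : R) g X -> is_derive t (1 : R) p b ->
  is_derive t (1 : R) (g \o p) (b *: X).
Proof.
move=> [/derivable1_diffP dg gX] dp.
have := is_derive_comp dg dp; rewrite -gX deriveE//.
by rewrite -linearZ /= [b *: 1]mulr1.
Qed.

Lemma is_derive_map (n m : nat) (f : 'rV[R]_n -> 'rV[R]_m) (g : R -> 'rV[R]_n) t X :
  differentiable f (g t) -> is_derive t (1 : R) g X ->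
  is_derive t (1 : R) (f \o g) (X *m jacobian f (g t)).
Proof.
by move=> df dg; rewrite -deriveEjacobian// deriveE//; exact: is_derive_comp.
Qed.

Lemma is_derive_continuous (V : normedModType R) (g : R -> V) t X :
  is_derive t (1 : R) g X -> {for t, continuous g}.
Proof. by move=> [/derivable1_diffP/differentiable_continuous]. Qed.

Lemma derive_grad (n : nat) (f : 'rV[R]_n -> R) x v :
  differentiable f x -> 'd f x v = (v *m (grad f x)^T) 0 0.
Proof.
move=> df; rewrite {1}(row_sum_delta v) linear_sum /= mxE; apply: eq_bigr => i _.
by rewrite linearZ /= !mxE deriveE.
Qed.

Lemma grad_comp (n m : nat) (T : 'rV[R]_n -> 'rV[R]_m) (g : 'rV[R]_m -> R) x :
  differentiable T x -> differentiable g (T x) ->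
  grad (g \o T) x = grad g (T x) *m (jacobian T x)^T.
Proof.
move=> dT dg; apply/rowP => i; rewrite !mxE.
have dgT : differentiable (g \o T) x by exact: differentiable_comp.
rewrite deriveE// diff_comp// [LHS]/= derive_grad// -deriveE// deriveEjacobian// !mxE.
by apply: eq_bigr => j _; rewrite -rowE !mxE mulrC.
Qed.

Lemma near_eq_grad (n : nat) (f g : 'rV[R]_n -> R) x :
  (\forall y \near x, f y = g y) -> grad f x = grad g x.
Proof. by move=> fg; apply/rowP => i; rewrite !mxE (near_eq_derive _ fg). Qed.

(** Change of coordinates for Hamiltonian vectors. Read [X O^T = g] as: [X] is
    the Hamiltonian vector of the covector [g] for the form [O]. If [J] is the
    Jacobian of a map that multiplies the form by [e], then [X J] is the
    Hamiltonian vector of the image covector times [e]. The case [e = 1] is used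
    for charts, the case [e = -1] for the anti-canonical involution. *)
Lemma symplectic_transport (n : nat) (J O O' : 'M[R]_n) (e : R) (X g : 'rV[R]_n) :
  J *m O' *m J^T = e *: O -> e != 0 -> O \in unitmx ->
  X *m O^T = g *m J^T -> (X *m J) *m O'^T = e *: g.
Proof.
move=> JO e0 Ou XO.
have : J *m O' *m J^T \in unitmx by rewrite JO unitmxZ// unitfE.
rewrite !unitmx_mul => /andP[_ JTu].
apply: (can_inj (mulmxK JTu)).
have := congr1 trmx JO; rewrite !trmx_mul trmxK linearZ /= => JOT.
by rewrite -scalemxAl -XO scalemxAr -JOT !mulmxA.
Qed.

End Curves.

(** * Solutions of a Hamiltonian system on a manifold *)

Section Solutions.
Variables (R : realType) (M : symplectic4 R).
Implicit Types (H : M -> R) (x : R -> M).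

Lemma hamvecP H (c : chart R M) y X : Defs.form c y \in unitmx ->
  X *m (Defs.form c y)^T = grad (H \o cinv c) y -> X = hamvec H c y.
Proof. by move=> fu; rewrite /hamvec => <-; rewrite trmx_inv mulmxK// unitmx_tr. Qed.

Lemma hamvecE H (c : chart R M) y : Defs.form c y \in unitmx ->
  hamvec H c y *m (Defs.form c y)^T = grad (H \o cinv c) y.
Proof. by move=> fu; rewrite /hamvec trmx_inv mulmxKV// unitmx_tr. Qed.

Lemma cimg_cmap (c : chart R M) q : cdom c q -> cimg c (cmap c q).
Proof. by move=> cq; exists q. Qed.

Lemma near_cdom (c : chart R M) (T : topologicalType) (f : T -> M) t :
  is_chart c -> cdom c (f t) -> {for t, continuous f} ->
  \forall s \near t, cdom c (f s).
Proof.
move=> [co _ _ _ _] cq fc; apply: fc; exact: open_nbhs_nbhs.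
Qed.

Lemma hamiltonian_differentiable H (c : chart R M) y :
  analytic_fun_on setT H -> atlas c -> cimg c y -> differentiable (H \o cinv c) y.
Proof.
move=> Ha ac [q cq <-]; apply: analytic_at_differentiable.
by apply: (Ha c ac); exists q.
Qed.

Lemma near_eq_solves H x y t :
  (\forall s \near t, x s = y s) -> solves_at H x t -> solves_at H y t.
Proof.
move=> xy [xc xd]; have xyt := nbhs_singleton xy; split.
  by move=> A /=; rewrite -xyt => /xc Ax; apply: filterS2 xy Ax => s /= <-.
move=> c ac; rewrite -xyt => cx.
apply: near_eq_is_derive (xd c ac cx); near=> s => /=; congr (cmap c _).
by near: s.
Unshelve. all: by end_near. Qed.

Lemma solves_reparam_shift H x a t :
  solves_at H x (t + a) -> solves_at H (fun s => x (s + a)) t.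
Proof.
move=> [xc xd]; split.
  apply: continuous_comp; last exact: xc.
  by apply: cvgD; [exact: cvg_id|exact: cvg_cst].
move=> c ac cx; rewrite -[hamvec _ _ _]scale1r.
apply: (@is_derive_reparam _ _ (cmap c \o x) (fun s => s + a)); first exact: xd.
by rewrite -[X in is_derive _ _ _ X]addr0; apply: is_deriveD.
Qed.

Definition glue (T : Type) (t0 : R) (x y : R -> T) : R -> T :=
  fun s => if s <= t0 then x s else y s.

Lemma is_derive_glue (V : normedModType R) (g1 g2 : R -> V) t0 X :
  is_derive t0 (1 : R) g1 X -> is_derive t0 (1 : R) g2 X -> g1 t0 = g2 t0 ->
  is_derive t0 (1 : R) (glue t0 g1 g2) X.
Proof.
move=> /is_derive_cvgP d1 /is_derive_cvgP d2 g12; apply/is_derive_cvgP.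
move=> A AX.
have A1 : \forall h \near (0 : R)^', A (h^-1 *: (g1 (h *: 1 + t0) - g1 t0)).
  exact: d1.
have A2 : \forall h \near (0 : R)^', A (h^-1 *: (g2 (h *: 1 + t0) - g2 t0)).
  exact: d2.
change (\forall h \near (0 : R)^',
  A (h^-1 *: (glue t0 g1 g2 (h *: 1 + t0) - glue t0 g1 g2 t0))).
near=> h; rewrite {2}/glue lexx /glue; case: ifP => _; first by near: h.
by rewrite g12; near: h.
Unshelve. all: by end_near. Qed.

(** Both branches solve the equation in a two-sided sense at the junction,
    hence they have the same derivative there, which is that of the glued curve. *)
Lemma solves_glue H x y t0 t : x t0 = y t0 ->
  (t <= t0 -> solves_at H x t) -> (t0 <= t -> solves_at H y t) ->
  solves_at H (glue t0 x y) t.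
Proof.
move=> xy sx sy; case: (ltgtP t t0) => [tt0|t0t|e].
- apply: near_eq_solves (sx (ltW tt0)); near=> s; rewrite /glue ifT//.
  by apply: ltW; near: s; exact: lt_nbhsl.
- apply: near_eq_solves (sy (ltW t0t)); near=> s; rewrite /glue ifF//.
  by apply/negbTE; rewrite -ltNge; near: s; exact: lt_nbhsr.
- subst t; have [xc xd] := sx (lexx _); have [yc yd] := sy (lexx _).
  have gt0 : glue t0 x y t0 = x t0 by rewrite /glue lexx.
  split.
    move=> A /=; rewrite gt0 => Ax.
    have A1 : \forall s \near t0, A (x s) by exact: xc.
    have A2 : \forall s \near t0, A (y s) by apply: yc; rewrite -xy.
    change (\forall s \near t0, A (glue t0 x y s)).
    by near=> s; rewrite /glue; case: ifP => _; near: s.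
  move=> c ac; rewrite gt0 => cx.
  have -> : cmap c \o glue t0 x y = glue t0 (cmap c \o x) (cmap c \o y).
    by apply/funext => s /=; rewrite /glue; case: ifP.
  apply: is_derive_glue; [exact: xd| |by rewrite /= xy].
  by rewrite xy; apply: yd => //; rewrite -xy.
Unshelve. all: by end_near. Qed.

Section Reversal.
Variables (H : M -> R) (L : M -> M).
Hypotheses (Ha : analytic_fun_on setT H) (La : analytic_self_map L)
  (Lc : anticanonical L) (HL : forall q, H (L q) = H q).

(** The involution reverses the sign of the symplectic form and preserves the
    Hamiltonian, so it reverses the sign of the vector field; reversing time
    as well gives a solution again. *)
Lemma solves_reversed x t :
  solves_at H x (- t) -> solves_at H (fun s => L (x (- s))) t.
Proof.
move=> [xc xd].
have xNc : {for t, continuous (fun s => x (- s))}.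
  by apply: continuous_comp; [exact: opp_continuous|exact: xc].
have [c ac cx] := atlas_cover (x (- t)).
have chc := atlas_chart ac; have [co ico cK cmc cic] := chc.
split; first by apply: continuous_comp xNc _; exact: La.1.
move=> c' ac' c'x; have chc' := atlas_chart ac'; have [co' _ cK' _ _] := chc'.
pose y := cmap c (x (- t)); pose Lam := cmap c' \o (L \o cinv c).
have cy : cimg c y by exact: cimg_cmap.
have Ly : L (cinv c y) = L (x (- t)) by rewrite cK.
have Ldiff : differentiable Lam y.
  apply: (analytic_map_differentiable ((La.2 c ac).2 c' ac')); split=> //=.
  by rewrite Ly.
have dNx : is_derive t (1 : R) (fun s => cmap c (x (- s))) (-1 *: hamvec H c y).
  by apply: (@is_derive_reparam _ _ (cmap c \o x) (fun s => - s)); exact: xd.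
have := @is_derive_map _ _ _ Lam _ _ _ Ldiff dNx.
move=> dL.
have e : (-1 *: hamvec H c y) *m jacobian Lam y = hamvec H c' (cmap c' (L (x (- t)))).
  have fu' : Defs.form c' (cmap c' (L (x (- t)))) \in unitmx.
    by apply: form_nondegenerate => //; exact: cimg_cmap.
  have fu : Defs.form c y \in unitmx by exact: form_nondegenerate.
  apply: hamvecP => //.
  rewrite -scalemxAl -scalemxAl.
  rewrite (@symplectic_transport _ _ _ (Defs.form c y) _ (-1) _
    (grad (H \o cinv c') (Lam y))) //.
  - by rewrite scalerA mulrNN mulr1 scale1r /Lam /= Ly.
  - have := Lc ac ac' cx c'x; rewrite /= => ->; by rewrite scaleN1r.
  - rewrite hamvecE// -grad_comp//; last first.
      apply: hamiltonian_differentiable => //; rewrite /Lam /= Ly; exact: cimg_cmap.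
    apply: near_eq_grad; near=> z; rewrite /= cK' ?HL//.
    near: z; apply: (@near_cdom c' _ (L \o cinv c)) => //=; first by rewrite Ly.
    exact: (La.2 c ac).1.
rewrite -e; apply: near_eq_is_derive dL; near=> s.
rewrite /Lam /= cK//.
by near: s; exact: (@near_cdom c _ (fun s => x (- s)) t).
Unshelve. all: by end_near. Qed.

Lemma flows_reversed q s q' : flows H q s q' -> flows H (L q') s (L q).
Proof.
move=> [x [x0 xs sx]]; exists (fun t => L (x (- t + s))).
split; rewrite ?oppr0 ?add0r ?addNr ?x0 ?xs// => t /andP[t0 ts].
apply: (@solves_reversed (fun r => x (r + s))); apply: solves_reparam_shift.
by apply: sx; rewrite addrC subr_ge0 ts lerBlDr lerDl t0.
Qed.

End Reversal.

Lemma flows_cat H q s q' s' q'' : 0 <= s -> 0 <= s' ->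
  flows H q s q' -> flows H q' s' q'' -> flows H q (s + s') q''.
Proof.
move=> s0 s'0 [x [x0 xs sx]] [y [y0 ys sy]].
pose z := glue s x (fun t => y (t - s)).
have xy : x s = y (s - s) by rewrite subrr xs y0.
exists z; split.
- by rewrite /z /glue s0.
- rewrite /z /glue; case: ifP => [h|_]; last by rewrite addrAC subrr add0r.
  have s'e : s' = 0 by apply/eqP; rewrite eq_le s'0 andbT -(lerD2l s) addr0.
  by rewrite s'e addr0 xs -ys s'e y0.
- move=> t /andP[t0 tss]; apply: solves_glue => // h.
    by apply: sx; rewrite t0.
  by apply: solves_reparam_shift; apply: sy; rewrite subr_ge0 h lerBlDl.
Qed.

(** A curve that solves the equation in one Darboux chart, which may lie outside
    the atlas, is a solution in every chart of the atlas. *)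
Lemma solves_darboux H (k : chart R M) (s : R -> 'rV[R]_4) t X :
  analytic_fun_on setT H -> darboux_chart k -> cimg k (s t) ->
  is_derive t (1 : R) s X -> X *m (std4 R)^T = grad (H \o cinv k) (s t) ->
  std4 R \in unitmx ->
  solves_at H (cinv k \o s) t.
Proof.
move=> Ha [[chk kc] kd] kst ds Xg u4.
have [ko iko kK kmc kic] := chk.
split.
  apply: continuous_comp; [exact: is_derive_continuous ds|exact: kic].
move=> c ac cst; have chc := atlas_chart ac; have [co _ cK _ _] := chc.
have ost : overlap k c (s t).
  by case: (kst) => q kq qe; exists q => //; split => //; rewrite -(kK _ kq) qe.
have dT : differentiable (transition k c) (s t).
  exact: (analytic_map_differentiable (kc c ac).2 ost).
have := is_derive_map dT ds.
have cimgT : cimg c (transition k c (s t)) by exact: cimg_cmap.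
have fu : Defs.form c (transition k c (s t)) \in unitmx by exact: form_nondegenerate.
suff -> : X *m jacobian (transition k c) (s t) = hamvec H c (transition k c (s t)).
  by [].
apply: hamvecP => //.
rewrite (@symplectic_transport _ _ _ (std4 R) _ 1 _
  (grad (H \o cinv c) (transition k c (s t)))) //.
- by rewrite scale1r.
- by rewrite scale1r kd.
- rewrite Xg -grad_comp//; last exact: hamiltonian_differentiable.
  apply: near_eq_grad; near=> z; rewrite /transition /= cK//.
  by near: z; apply: (@near_cdom c _ (cinv k) (s t)) => //; exact: kic.
Unshelve. all: by end_near. Qed.

End Solutions.

(** * Composition and reversal of maps along the flow *)

Section FlowMaps.
Variables (R : realType) (M : symplectic4 R) (H : M -> R).
Implicit Types (A B : set 'rV[R]_2) (P Q : 'rV[R]_2 -> M).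

Lemma flow_map_comp A B P Q Q' G G' tau tau' :
  flow_map H A P Q G tau -> flow_map H B Q Q' G' tau' ->
  (forall w, A w -> B (G w)) -> (forall w, A w -> {for w, continuous G}) ->
  flow_map H A P Q' (G' \o G) (fun w => tau w + tau' (G w)).
Proof.
move=> fG fG' AB Gc w Aw.
have [t0 tc fl] := fG w Aw; have [t0' tc' fl'] := fG' _ (AB w Aw).
split; first exact: addr_gt0.
  have c2 : {for w, continuous (tau' \o G)}.
    by apply: continuous_comp; [exact: Gc|exact: tc'].
  exact: (continuousD tc c2).
exact: (flows_cat (ltW t0) (ltW t0') fl fl').
Qed.

Section Iteration.
Variables (A B : set 'rV[R]_2) (P Q : 'rV[R]_2 -> M).
Variables (G S : 'rV[R]_2 -> 'rV[R]_2) (tau tauS : 'rV[R]_2 -> R).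
Hypotheses (fG : flow_map H A P Q G tau) (fS : flow_map H B Q Q S tauS).
Hypotheses (Gc : forall w, A w -> {for w, continuous G})
  (Sc : forall w, B w -> {for w, continuous S}).

Definition iter_dom (n : nat) : set 'rV[R]_2 :=
  [set w | A w /\ forall k, (k < n)%N -> B (iter k S (G w))].

Lemma iter_continuous n w : iter_dom n w ->
  {for w, continuous (fun w => iter n S (G w))}.
Proof.
elim: n => [|n IHn] [Aw Bw]; first exact: Gc.
apply: (@continuous_comp _ _ _ (fun w => iter n S (G w)) S).
  by apply: IHn; split=> // k kn; apply: Bw; exact: ltnW.
exact/Sc/Bw.
Qed.

Lemma flow_map_iter n : exists tau' : 'rV[R]_2 -> R,
  flow_map H (iter_dom n) P Q (fun w => iter n S (G w)) tau'.
Proof.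
elim: n => [|n [t IHn]]; first by exists tau => w [Aw _]; exact: fG.
exists (fun w => t w + tauS (iter n S (G w))).
have sub w : iter_dom n.+1 w -> iter_dom n w.
  by move=> [Aw Bw]; split=> // k kn; apply: Bw; exact: ltnW.
apply: (@flow_map_comp _ B P Q Q (fun w => iter n S (G w)) S t tauS) => //.
- by move=> w /sub /IHn.
- by move=> w [_ Bw]; exact: Bw.
- by move=> w /sub; exact: iter_continuous.
Qed.

Lemma iter_dom_near n w :
  A w -> (\forall z \near w, A z) ->
  (forall k, (k < n)%N -> B (iter k S (G w)) /\ open B) ->
  \forall z \near w, iter_dom n z.
Proof.
move=> Aw An; elim: n => [|n IHn] Bw.
  by near=> z; split => //; near: z.
have Bn k : (k < n)%N -> B (iter k S (G w)) /\ open B.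
  by move=> kn; apply: Bw; exact: ltnW.
have dn : iter_dom n w by split=> // k /Bn[].
have [Bnw Bo] := Bw n (ltnSn n).
have cn : \forall z \near w, B (iter n S (G z)).
  by apply: (iter_continuous dn); exact: open_nbhs_nbhs.
near=> z; have [Az Bz] : iter_dom n z by near: z; exact: IHn.
split=> // k; rewrite ltnS leq_eqVlt => /orP[/eqP ->|]; last exact: Bz.
by near: z.
Unshelve. all: by end_near. Qed.

End Iteration.

(** Conjugating a map along the flow by the involution gives its inverse in
    reversed order: here [X] and [Y] express the involution in the coordinates
    of the two surfaces. *)
Lemma flow_map_reversed A P P' Q G tau (L : M -> M) g (X Y : 'rV[R]_2 -> 'rV[R]_2) :
  analytic_fun_on setT H -> analytic_self_map L -> anticanonical L ->
  (forall q, H (L q) = H q) ->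
  flow_map H A P Q G tau ->
  (forall w, A w -> g (G w) = w) ->
  (forall y, (G @` A) y -> {for y, continuous g}) ->
  continuous X ->
  (forall y, (G @` A) (X y) -> L (Q (X y)) = Q y) ->
  (forall w, A w -> L (P w) = P' (Y w)) ->
  flow_map H [set y | (G @` A) (X y)] Q P' (fun y => Y (g (X y)))
    (fun y => tau (g (X y))).
Proof.
move=> Ha La Lc HL fG gG gc Xc LQ LP y /= Gy.
have [w Aw GwE] := Gy; have gXy : g (X y) = w by rewrite -GwE gG.
have [t0 tc fl] := fG w Aw; split; rewrite ?gXy//.
  apply: (@continuous_comp _ _ _ (g \o X) tau); last by rewrite /= gXy.
  by apply: continuous_comp; [exact: Xc|exact: gc].
by rewrite -LP// -LQ// -GwE; exact: flows_reversed.
Qed.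

End FlowMaps.

(** * Homoclinic orbits closed up by symmetry *)

Section Homoclinic.
Variables (R : realType) (M : symplectic4 R) (H : M -> R) (L : M -> M).
Hypotheses (Ha : analytic_fun_on setT H) (La : analytic_self_map L)
  (Lc : anticanonical L) (HL : forall q, H (L q) = H q).

(** An orbit that leaves [p] along [u] and meets the mirror image of [u] is
    closed up by the reversed mirror image of [u], along which it returns to
    [L p = p]. *)
Lemma symmetric_homoclinic (p : M) (u : R -> M) (tau : R) :
  (forall t, t <= 0 -> solves_at H u t) -> u t @[t --> -oo] --> p ->
  L p = p -> u 0 <> p -> 0 < tau -> flows H (u 0) tau (L (u 0)) ->
  exists x, [/\ homoclinic_orbit H p x, x 0 = u 0 & x tau = L (u 0)].
Proof.
move=> su up Lp u0 tau0 [m [m0 mtau sm]].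
pose v (t : R) := L (u (- t + tau)).
pose x := glue 0 u (glue tau m v).
have sv t : tau <= t -> solves_at H v t.
  move=> taut; apply: (@solves_reversed _ _ _ _ Ha La Lc HL (fun s => u (s + tau))).
  by apply: solves_reparam_shift; apply: su; rewrite addrC subr_le0.
have x0 : x 0 = u 0 by rewrite /x /glue lexx.
exists x; split => //; last first.
  by rewrite /x /glue leNgt tau0 /= lexx.
split.
- move=> t; apply: solves_glue; first by rewrite /glue (ltW tau0).
    exact: su.
  move=> t0; apply: solves_glue.
  + by rewrite /v addNr.
  + by move=> tt; apply: sm; rewrite t0.
  + exact: sv.
- by exists 0; rewrite x0.
- have vp : v t @[t --> +oo] --> p.
    have up' : u (- t + tau) @[t --> +oo] --> p.
      apply: cvg_comp up => A [m1 [m1r mA]].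
      exists (tau - m1); split; first exact: num_real.
      by move=> t tt /=; apply: mA; rewrite addrC ltrBlDr -ltrBlDl.
    have Lcp : L @ p --> L p by exact: La.1.
    by rewrite Lp in Lcp; exact: (cvg_comp _ _ up' Lcp).
  move=> A /vp vA; rewrite /= in vA.
  change (\forall t \near +oo, A (x t)).
  have vA' : \forall t \near +oo, A (v t) by exact: vA.
  near=> t; have tt : tau < t by near: t; apply: nbhs_pinfty_gt; exact: num_real.
  rewrite /x /glue leNgt (lt_trans tau0 tt) /= leNgt tt /=.
  by near: t.
- move=> A /up uA; change (\forall t \near -oo, A (x t)).
  have uA' : \forall t \near -oo, A (u t) by exact: uA.
  near=> t; rewrite /x /glue ifT; first by near: t.
  by near: t; apply: nbhs_ninfty_le; exact: num_real.
Unshelve. all: by end_near. Qed.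

End Homoclinic.

(** * The standard symplectic matrix *)

Section Separatrix.
Variable R : realType.

Lemma vec4E (a b c d : R) : vec4 a b c d = row_mx (vec2 a b) (vec2 c d) :> 'rV_(2 + 2).
Proof.
apply/rowP => i; rewrite !mxE; case: splitP => j ij; rewrite !mxE ij.
  by case: j ij => [[|[|]]].
by case: j ij => [[|[|]]].
Qed.

Lemma vec2_std2 (a b : R) : vec2 a b *m (std2 R)^T = vec2 b (- a).
Proof.
apply/rowP => i; rewrite !mxE 2!big_ord_recl big_ord0 !mxE /=.
by case: i => [[|[|]]] //= _;
  rewrite ?subr0 ?sub0r ?subrr ?mulr0 ?mulr1 ?add0r ?addr0 ?mulrN1.
Qed.

Lemma vec4_std4 (a b c d : R) : vec4 a b c d *m (std4 R)^T = vec4 b (- a) d (- c).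
Proof.
rewrite !vec4E /std4 (@tr_block_mx _ 2 2 2 2) (@mul_row_block _ 1 2 2 2 2).
rewrite !trmx0 !mulmx0 addr0 add0r.
by rewrite !vec2_std2.
Qed.

Lemma std4_unit : std4 R \in unitmx.
Proof.
have h2 : std2 R *m std2 R = - 1%:M.
  apply/matrixP => i j; rewrite !mxE 2!big_ord_recl big_ord0 !mxE /=.
  case: i => [[|[|]]] //= i2; case: j => [[|[|]]] //= j2;
  rewrite -?val_eqE /=; ring.
suff : std4 R *m (- std4 R) = 1%:M by case/mulmx1_unit.
rewrite /std4 mulmxN (@mulmx_block _ 2 2 2 2 2 2) !mulmx0 !mul0mx !addr0 !add0r h2.
rewrite (@opp_block_mx _ 2 2 2 2) !oppr0 opprK.
by symmetry; exact: (@scalar_mx_block _ 2 2).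
Qed.

End Separatrix.

(** * Smooth dependence on a parameter *)

Section Smooth.
Variable R : realType.

Lemma smooth_continuous (V W : normedModType R) (U : set V) (f : V -> W) x :
  smooth_on U f -> U x -> {for x, continuous f}.
Proof. by move=> /(_ 0%N)[fc _]; exact: fc. Qed.

Lemma smooth_derivable (V W : normedModType R) (U : set V) (f : V -> W) x v :
  smooth_on U f -> U x -> derivable f x v.
Proof. by move=> /(_ 1%N)[_ /(_ v)[fd _]]; exact: fd. Qed.

Lemma smooth_derive_continuous (V W : normedModType R) (U : set V) (f : V -> W) x v :
  smooth_on U f -> U x -> {for x, continuous (fun y => 'D_v f y : W)}.
Proof. by move=> /(_ 1%N)[_ /(_ v)[_ [fd _]]]; exact: fd. Qed.

Lemma continuous_pair (V W : normedModType R) (f : R -> V) (g : R -> W) m :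
  {for m, continuous f} -> {for m, continuous g} ->
  {for m, continuous (fun t => (f t, g t))}.
Proof.
move=> fc gc.
exact: (@filter.cvg_pair _ _ _ (nbhs m) (nbhs (f m)) (nbhs (g m)) _ _ _ f g fc gc).
Qed.

Lemma slice_continuous (V : normedModType R) (m : R) (x : V) :
  {for x, continuous (fun y : V => (m, y))}.
Proof.
exact: (@filter.cvg_pair _ _ _ (nbhs x) (nbhs m) (nbhs x) _ _ _ (fun=> m) id
          (cvg_cst _) cvg_id).
Qed.

Lemma quotient_slice (V W : normedModType R) (f : R -> V -> W) m (x v : V) :
  (fun h : R => h^-1 *: ((f m \o shift x) (h *: v) - f m x)) =
  (fun h : R => h^-1 *: (((fun z : R * V => f z.1 z.2) \o shift (m, x))
      (h *: ((0, v) : R * V)) - f m x)).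
Proof. by apply/funext => h /=; rewrite [h *: 0]mulr0 add0r. Qed.

Lemma derivable_slice (V W : normedModType R) (f : R -> V -> W) m (x v : V) :
  derivable (fun z : R * V => f z.1 z.2) (m, x) (0, v) -> derivable (f m) x v.
Proof. by rewrite /derivable /= quotient_slice. Qed.

Lemma derive_slice (V W : normedModType R) (f : R -> V -> W) m (x v : V) :
  'D_v (f m) x = 'D_((0, v) : R * V) (fun z : R * V => f z.1 z.2) (m, x).
Proof. by rewrite /derive /= quotient_slice. Qed.

Lemma slice_value_continuous (V W : normedModType R) (U : set (R * V))
    (f : R -> V -> W) (x : R -> V) m :
  smooth_on U (fun z => f z.1 z.2) -> U (m, x m) -> {for m, continuous x} ->
  {for m, continuous (fun m => f m (x m))}.
Proof.
move=> fs Ux xc.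
apply: (@continuous_comp _ _ _ (fun m => (m, x m)) (fun z => f z.1 z.2)).
  by apply: (@continuous_pair _ _ (fun m : R => m)) => //; exact: cvg_id.
exact: (smooth_continuous fs).
Qed.

Lemma slice_derive_continuous (V W : normedModType R) (U : set (R * V))
    (f : R -> V -> W) (x : R -> V) m v :
  smooth_on U (fun z => f z.1 z.2) -> U (m, x m) -> {for m, continuous x} ->
  {for m, continuous (fun m => 'D_v (f m) (x m) : W)}.
Proof.
move=> fs Ux xc.
rewrite (_ : (fun m => _) =
    (fun z => 'D_((0, v) : R * V) (fun z => f z.1 z.2) z) \o (fun m => (m, x m)));
  last by apply/funext => m'; rewrite /= derive_slice.
apply: continuous_comp.
  by apply: (@continuous_pair _ _ (fun m : R => m)) => //; exact: cvg_id.
exact: (smooth_derive_continuous fs).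
Qed.

Lemma cube_open (n : nat) (r : R) : open (cube r : set 'rV[R]_n).
Proof.
rewrite openE => x xr; rewrite /interior.
apply: (@filter_forall _ _ (fun i (y : 'rV[R]_n) => `|y 0 i| < r) (nbhs x)) => i.
have : {for x, continuous (fun y : 'rV[R]_n => `|y 0 i|)}.
  apply: (@continuous_comp _ _ _ (fun y : 'rV[R]_n => y 0 i));
    last exact: norm_continuous.
  exact: coord_continuous.
move=> /(_ [set y | y < r]); apply; apply: open_nbhs_nbhs; split; last exact: xr.
exact: open_lt.
Qed.

Lemma cube0 (n : nat) (r : R) : 0 < r -> cube r (0 : 'rV[R]_n).
Proof. by move=> r0 i; rewrite mxE normr0. Qed.

Lemma is_derive_scalel (V : normedModType R) (t : R) (e : V) :
  is_derive t (1 : R) (fun s : R => s *: e) e.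
Proof.
have df := is_diff_scalel t e.
have dd : differentiable (fun s : R => s *: e) t by exact: ex_diff.
apply: DeriveDef; first exact/derivable1_diffP.
by rewrite deriveE// diff_val scale1r.
Qed.

(** If [f] depends on [t] only through [h (p t e)] along the line [x + t v], its
    derivative is computed by the chain rule. This gives the four partial
    derivatives of a function of [xi] and [eta] on the [x1]-axis. *)
Lemma derive_through (n m : nat) (h : 'rV[R]_m -> R) (f : 'rV[R]_n -> R) x v e
    (p : R -> R) (b c0 : R) :
  differentiable h 0 -> p 0 = 0 -> is_derive (0 : R) (1 : R) p b ->
  (\forall t \near (0 : R), f (t *: v + x) = c0 + h (p t *: e)) ->
  'D_v f x = b * 'D_e h 0.
Proof.
move=> dh p0 dp fE.
have dpe : is_derive (0 : R) (1 : R) (fun t => p t *: e) (b *: e).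
  apply: (@is_derive_reparam _ _ (fun t : R => t *: e) p) => //.
  exact: is_derive_scalel.
have dhp : is_derive (0 : R) (1 : R) (fun t => c0 + h (p t *: e)) (b * 'D_e h 0).
  rewrite -[b * _]add0r; apply: is_deriveD.
  have := @is_derive_comp _ _ _ h (fun t => p t *: e) 0 _ _ dpe.
  by rewrite p0 scale0r linearZ /= -deriveE//; apply.
have /is_derive_cvgP :
    is_derive (0 : R) (1 : R) (fun t => f (t *: v + x)) (b * 'D_e h 0).
  by apply: near_eq_is_derive dhp; near=> t; apply: esym; near: t.
move=> fd; apply: (cvg_lim _) => //.
under eq_fun => t do rewrite /=.
move: fd; under eq_fun => t do rewrite addr0 [t *: 1]mulr1 scale0r add0r; exact.
Unshelve. all: by end_near. Qed.

End Smooth.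

(** * The unstable separatrix of the saddle-center *)

Section LocalSeparatrix.
Variables (R : realType) (M : symplectic4 R) (F : ham_family M)
  (P : saddle_center_data M) (D : disk_data R) (ty : connection_type).
Hypotheses (hF : reversible_family F) (hP : saddle_center_family F P ty)
  (hD : disk_family F P D).

Lemma ham_analytic mu : `|mu| < mu_max F -> analytic_fun_on setT (ham F mu).
Proof. by case: hF => _ _ _ + mm => /(_ mu mm)[]. Qed.

(** The Hamiltonian equations on the [x1]-axis are [x1' = - xi_rate x1]; at the
    parameter value 0 the normalization of the normal form gives [-1]. *)
Definition xi_rate (mu : R) : R := 'D_(delta_mx 0 0) (hnf P mu) 0.

(** On the [x1]-axis both [xi] and [eta] vanish; [eta] has zero differential
    there, and [xi] varies only with [y1], at the rate [X]. *)
Lemma normal_form_grad mu (X : R) : `|mu| < mu_max F -> `|X| < rho P ->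
  grad (ham F mu \o cinv (loc P mu)) (vec4 X 0 0 0) = vec4 0 (xi_rate mu * X) 0 0.
Proof.
move=> mm Xr; have r0 := scf_rho hP.
have dh : differentiable (hnf P mu) 0.
  by apply/analytic_at_differentiable/(scf_hnf_analytic hP mm)/cube0; exact: exprn_gt0.
have x0 : cube (rho P) (vec4 X 0 0 0).
  by move=> i; rewrite mxE; case: i => [[|[|[|[|]]]]] //= _; rewrite normr0.
have near_cube (v : 'rV[R]_4) :
    \forall t \near (0 : R), cube (rho P) (t *: v + vec4 X 0 0 0).
  have : {for (0 : R), continuous (fun t : R => t *: v + vec4 X 0 0 0)}.
    by apply: cvgD; [exact: scalel_continuous|exact: cvg_cst].
  apply; rewrite scale0r add0r; apply: open_nbhs_nbhs; split => //; exact: cube_open.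
have key (i : 'I_4) (e : 'rV[R]_2) (p : R -> R) (b : R) :
    p 0 = 0 -> is_derive (0 : R) (1 : R) p b ->
    (forall t : R, xi_eta (t *: delta_mx 0 i + vec4 X 0 0 0) = p t *: e) ->
    'D_(delta_mx 0 i) (ham F mu \o cinv (loc P mu)) (vec4 X 0 0 0) =
    b * 'D_e (hnf P mu) 0.
  move=> p0 dp pE.
  apply: (@derive_through _ _ _ _ _ _ _ e p b (ham F mu (pmu P mu))) => //.
  near=> t; rewrite /= (scf_ham hP)// ?pE//.
  by near: t; exact: near_cube.
have sq : is_derive (0 : R) (1 : R) (fun t : R => t ^+ 2 / 2) 0.
  have -> : (fun t : R => t ^+ 2 / 2) = 2^-1 *: (id * id).
    by apply/funext => t; rewrite mulrC.
  by apply: is_derive_eq; rewrite !scale0r addr0 scaler0.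
have sq0 : 0 ^+ 2 / 2 = 0 :> R by rewrite expr0n mul0r.
have dX : is_derive (0 : R) (1 : R) (fun t : R => X * t) X.
  have -> : (fun t : R => X * t) = X *: id by [].
  by apply: is_derive_eq; rewrite [_ *: 1]mulr1.
apply/rowP => i; rewrite !mxE.
case: i => [[|[|[|[|]]]]] //= i4.
- rewrite (@key _ 0 (fun=> 0) 0 erefl (is_derive_cst _ _ _)) ?mul0r//.
  move=> t; apply/rowP => j; rewrite !mxE /=.
  by case: j => [[|[|]]] //= _; rewrite ?mulr0 ?addr0 ?mulr0 ?expr0n /= ?addr0 ?mul0r.
- rewrite (@key _ (delta_mx 0 0) (fun t => X * t) X (mulr0 X) dX); first by rewrite mulrC.
  move=> t; apply/rowP => j; rewrite !mxE /=.
  by case: j => [[|[|]]] //= _;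
    rewrite ?mulr0 ?addr0 ?add0r ?mulr1 ?mulr0 ?expr0n /= ?addr0 ?mul0r.
- rewrite (@key _ (delta_mx 0 1) (fun t => t ^+ 2 / 2) 0 sq0 sq) ?mul0r//.
  move=> t; apply/rowP => j; rewrite !mxE /=.
  by case: j => [[|[|]]] //= _;
    rewrite ?mulr0 ?addr0 ?add0r ?mulr1 ?mulr0 ?expr0n /= ?addr0 ?mul0r.
- rewrite (@key _ (delta_mx 0 1) (fun t => t ^+ 2 / 2) 0 sq0 sq) ?mul0r//.
  move=> t; apply/rowP => j; rewrite !mxE /=.
  by case: j => [[|[|]]] //= _;
    rewrite ?mulr0 ?addr0 ?add0r ?mulr1 ?mulr0 ?expr0n /= ?addr0 ?add0r ?mul0r.
Unshelve. all: by end_near. Qed.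

Lemma chart_point mu x : `|mu| < mu_max F -> cube (rho P) x ->
  cmap (loc P mu) (cinv (loc P mu) x) = x.
Proof.
move=> mm xr; have [[[[_ _ kK _ _] _] _] im _ _] := scf_chart hP mm.
by move: xr; rewrite -im => -[q kq <-]; rewrite kK.
Qed.

Lemma pmuE mu : `|mu| < mu_max F -> cinv (loc P mu) 0 = pmu P mu.
Proof.
move=> mm; have [[[[_ _ kK _ _] _] _] im pk p0] := scf_chart hP mm.
by rewrite -p0 kK.
Qed.

Lemma pmu_symmetric mu : `|mu| < mu_max F -> invol F (pmu P mu) = pmu P mu.
Proof.
move=> mm; rewrite -pmuE// (scf_invol hP mm); last exact/cube0/(scf_rho hP).
congr cinv; apply/rowP => i; case: ty; rewrite /= !mxE ?oppr0;
  by case: i => [[|[|[|[|]]]]].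
Qed.

(** In both types the involution carries the [y1]-axis, on which the origin of
    the first disk lies, onto the [x1]-axis; the types differ by the sign of [X]. *)
Lemma D2_origin : exists2 X : R, X != 0 /\ `|X| < rho P &
  forall mu, `|mu| < mu_max F -> D2 F P D mu 0 = cinv (loc P mu) (vec4 X 0 0 0).
Proof.
have [[d0 dr] _ _ hx] := hD.
exists (if ty is Type1 then dsec D else - dsec D).
  by case: ty; rewrite ?normrN ?oppr_eq0.
move=> mu mm; have [x0 _ _] := hx _ mm.
rewrite /D2 /D1 !mxE /= oppr0 (_ : vec2 0 0 = 0); last first.
  by apply/rowP => i; rewrite !mxE; case: i => [[|[|]]].
rewrite x0 (scf_invol hP mm); last first.
  move=> i; rewrite mxE; case: i => [[|[|[|[|]]]]] //= _; rewrite ?normr0//;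
    exact: scf_rho hP.
congr cinv; apply/rowP => i; case: ty; rewrite /= !mxE /= ?oppr0;
  by case: i => [[|[|[|[|]]]]].
Qed.

(** The solution is explicit: on the [x1]-axis it is [X exp (- xi_rate t)], which
    decreases to the equilibrium as [t] tends to minus infinity. *)
Lemma unstable_separatrix mu : `|mu| < mu_max F -> xi_rate mu < 0 ->
  exists u : R -> M, [/\ forall t, t <= 0 -> solves_at (ham F mu) u t,
    u t @[t --> -oo] --> pmu P mu, u 0 = D2 F P D mu 0 & u 0 <> pmu P mu].
Proof.
move=> mm c0; have [X [X0 Xr] D2E] := D2_origin.
set c := xi_rate mu in c0.
have [dk im pk p0] := scf_chart hP mm.
have [[[_ _ _ _ kic] _] _] := dk.
pose s (t : R) : 'rV[R]_4 := (X * expR (- c * t)) *: delta_mx 0 0.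
have sE t : s t = vec4 (X * expR (- c * t)) 0 0 0.
  apply/rowP => i; rewrite !mxE.
  by case: i => [[|[|[|[|]]]]] //= _; rewrite ?mulr1 ?mulr0.
have Xt t : t <= 0 -> `|X * expR (- c * t)| < rho P.
  move=> t0; apply: le_lt_trans Xr; rewrite normrM ler_piMr// ger0_norm ?expR_ge0//.
  by rewrite -expR0 ler_expR mulr_ge0_le0// oppr_ge0 ltW.
have ds t : is_derive t (1 : R) s (vec4 (- c * (X * expR (- c * t))) 0 0 0).
  have dp : is_derive t (1 : R) (fun t => X * expR (- c * t))
      (X * (expR (- c * t) * - c)).
    have dc : is_derive t (1 : R) (fun t => - c * t) (- c).
      have -> : (fun t => - c * t) = - c *: id by [].
      by apply: is_derive_eq; rewrite [_ *: 1]mulr1.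
    have de := @is_derive1_comp _ expR (fun t => - c * t) t _ _ (is_derive_expR _) dc.
    exact: (@is_deriveZ _ _ _ _ X _ _ _ de).
  have := is_derive_reparam (@is_derive_scalel _ _ _ (delta_mx 0 0 : 'rV[R]_4)) dp.
  congr is_derive; apply/rowP => i; rewrite !mxE.
  by case: i => [[|[|[|[|]]]]] //= _; rewrite ?mulr0 ?mulr1//; ring.
have s0 : s 0 = vec4 X 0 0 0 by rewrite sE mulr0 expR0 mulr1.
exists (cinv (loc P mu) \o s); split.
- move=> t t0; apply: (solves_darboux _ dk _ (ds t)) => //.
  + exact: ham_analytic.
  + rewrite im sE => i; rewrite mxE.
    by case: i => [[|[|[|[|]]]]] //= _; rewrite ?normr0 ?(scf_rho hP)//; exact: Xt.
  + rewrite sE vec4_std4 normal_form_grad//; last exact: Xt.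
    by rewrite oppr0 mulNr opprK.
  + exact: std4_unit.
- rewrite -pmuE//.
  have kc0 : {for 0, continuous (cinv (loc P mu))}.
    by apply: kic; rewrite im; exact/cube0/(scf_rho hP).
  have ct : c * t @[t --> -oo] --> +oo.
    move=> A [m [mr mA]]; exists (m / c); split; first exact: num_real.
    by move=> t tt /=; apply: mA; rewrite mulrC -ltr_ndivlMr.
  have ep : X * expR (- (c * t)) @[t --> -oo] --> X * 0.
    by apply: cvgMr; exact: (cvg_comp _ _ ct (@cvgr_expR R)).
  have sc : s t @[t --> -oo] --> (0 : 'rV[R]_4).
    have := cvg_comp _ _ ep (@scalel_continuous _ _ (delta_mx 0 0 : 'rV[R]_4) (X * 0)).
    have -> : s = (fun t => (X * expR (- (c * t))) *: delta_mx 0 0).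
      by apply/funext => t; rewrite /s mulNr.
    by rewrite mulr0 scale0r.
  exact: (cvg_comp _ _ sc kc0).
- by rewrite /= s0 D2E.
- rewrite /= -pmuE// s0 => e.
  have : vec4 X 0 0 0 = 0 :> 'rV[R]_4.
    rewrite -(chart_point mm (x := 0)) -?e ?chart_point//; last exact/cube0/(scf_rho hP).
    move=> i; rewrite mxE.
    by case: i => [[|[|[|[|]]]]] //= _; rewrite ?normr0 ?(scf_rho hP).
  by move/rowP/(_ 0); rewrite !mxE /= => /eqP; rewrite (negbTE X0).
Qed.

Lemma xi_rate_near : \forall mu \near (0 : R), xi_rate mu < 0.
Proof.
have mm : `|0 : R| < mu_max F by rewrite normr0; case: hF.
have c0 : xi_rate 0 = -1.
  have /rowP/(_ 0) := scf_grad hP; by rewrite !mxE.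
have U0 : [set z : R * 'rV[R]_2 | `|z.1| < mu_max F /\ cube (rho P ^+ 2) z.2] (0, 0).
  by split => //=; apply: cube0; rewrite exprn_gt0// (scf_rho hP).
have : {for (0 : R), continuous (xi_rate)}.
  apply: (slice_derive_continuous (x := fun=> 0) (scf_hnf_smooth hP) U0).
  exact: cvg_cst.
move=> /(_ [set y | y < 0]); apply; apply: open_nbhs_nbhs; split; first exact: open_lt.
by rewrite /= c0 ltrN10.
Qed.

End LocalSeparatrix.

(** * The section coordinates and the Poincare map *)

Section Planar.
Variable R : realType.

Lemma vec2_eta (w : 'rV[R]_2) : vec2 (w 0 0) (w 0 1) = w.
Proof.
apply/rowP => i; rewrite !mxE; case: i => [[|[|]]] //= i2; congr (w _ _);
  exact/val_inj.
Qed.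

Lemma vec2_0 (a b : R) : vec2 a b 0 0 = a. Proof. by rewrite mxE. Qed.
Lemma vec2_1 (a b : R) : vec2 a b 0 1 = b. Proof. by rewrite mxE. Qed.

Lemma row2P (x y : 'rV[R]_2) : x 0 0 = y 0 0 -> x 0 1 = y 0 1 -> x = y.
Proof. by move=> h0 h1; rewrite -[x]vec2_eta -[y]vec2_eta h0 h1. Qed.

Lemma differentiable_vec2 (V : normedModType R) (f g : V -> R) x :
  differentiable f x -> differentiable g x ->
  differentiable (fun y => vec2 (f y) (g y)) x.
Proof.
move=> df dg; apply: differentiable_row => j.
case: j => [[|[|]]] //= j2.
  rewrite (_ : (fun _ => _) = f)//.
  by apply/funext => y; rewrite mxE.
rewrite (_ : (fun _ => _) = g)//.
by apply/funext => y; rewrite mxE.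
Qed.

(** Smoothness is a statement about directional derivatives in the product of
    the parameter line and the plane; for a fixed parameter it yields continuous
    partial derivatives, hence a differential. *)
Lemma smooth_slice_differentiable (n k : nat) (U : set (R * 'rV[R]_n))
    (f : R -> 'rV[R]_n -> 'rV[R]_k) m x :
  open U -> smooth_on U (fun z => f z.1 z.2) -> U (m, x) ->
  differentiable (f m) x.
Proof.
move=> Uo fs Ux; apply: differentiable_row => j.
have near_U : \forall y \near x, U (m, y).
  have : {for x, continuous (fun y => (m, y))} by exact: slice_continuous.
  by apply; exact: open_nbhs_nbhs.
have dj i y : U (m, y) -> derivable (fun y => f m y 0 j) y (delta_mx 0 i).
  move=> Uy; have := derivable_slice (smooth_derivable (v := (0, delta_mx 0 i)) fs Uy).
  by move/derivable_mxP; apply.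
apply: differentiable_of_partials => i; first by near=> y; apply: dj; near: y.
have dE : \forall y \near x,
    'D_((0, delta_mx 0 i) : R * 'rV[R]_n) (fun z => f z.1 z.2) (m, y) 0 j =
    'D_(delta_mx 0 i) (fun y => f m y 0 j) y.
  near=> y; have Uy : U (m, y) by near: y.
  rewrite -derive_slice derive_mx ?mxE//.
  exact: derivable_slice (smooth_derivable (v := (0, delta_mx 0 i)) fs Uy).
rewrite /prop_for /continuous_at -(nbhs_singleton dE).
apply: cvg_trans (near_eq_cvg dE) _.
pose Df (z : R * 'rV[R]_n) :=
  'D_((0, delta_mx 0 i) : R * 'rV[R]_n) (fun z => f z.1 z.2) z.
apply: (@continuous_comp _ _ _ (fun y => Df (m, y)) (fun z : 'rV[R]_k => z 0 j));
  last exact: coord_continuous.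
apply: (@continuous_comp _ _ _ (fun y => (m, y)) Df).
  exact: slice_continuous.
exact: (smooth_derive_continuous fs Ux).
Unshelve. all: by end_near. Qed.

(** The involution between the two disks at the saddle-center, in the
    coordinates [(x2, y2)]. *)
Definition flip (w : 'rV[R]_2) : 'rV[R]_2 := vec2 (- w 0 0) (w 0 1).
(** The involution on the section of the periodic orbit, in the coordinates
    [(u, v)]. *)
Definition swap (w : 'rV[R]_2) : 'rV[R]_2 := vec2 (w 0 1) (w 0 0).

Lemma flipK w : flip (flip w) = w.
Proof. by apply: row2P; rewrite !mxE ?opprK. Qed.

Lemma swapK w : swap (swap w) = w.
Proof. by apply: row2P; rewrite !mxE. Qed.

Lemma flip0 : flip 0 = 0.
Proof. by apply: row2P; rewrite !mxE ?oppr0. Qed.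

Lemma cube_flip r w : cube r w -> cube r (flip w).
Proof.
move=> wr i; rewrite mxE; case: i => [[|[|]]] //= i2; first by rewrite normrN.
Qed.

Lemma differentiable_flip w : differentiable flip w.
Proof.
apply: differentiable_vec2; last exact: differentiable_coord.
by apply: differentiableN; exact: differentiable_coord.
Qed.

Lemma differentiable_swap w : differentiable swap w.
Proof. by apply: differentiable_vec2; exact: differentiable_coord. Qed.

Fact flip_linear : linear flip.
Proof. by move=> k x y; apply: row2P; rewrite !mxE /= ?opprD ?mulrN. Qed.
HB.instance Definition _ :=
  GRing.isLinear.Build R 'rV[R]_2 'rV[R]_2 _ flip flip_linear.

Lemma diff_flip w v : 'd flip w v = flip v.
Proof.
rewrite diff_lin// => x; exact/differentiable_continuous/differentiable_flip.
Qed.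

End Planar.

Section Poincare.
Variables (R : realType) (M : symplectic4 R) (F : ham_family M)
  (P : saddle_center_data M) (C : periodic_data M).
Hypothesis hC : saddle_periodic_family F P C.
Variable mu : R.
Hypothesis mm : `|mu| < mu_max F.

Lemma cube_prod (w : 'rV[R]_2) :
  cube (Defs.rad C) w -> `|w 0 0 * w 0 1| < Defs.rad C ^+ 2.
Proof.
by move=> wr; rewrite normrM expr2 ltr_pM.
Qed.

Lemma fnf_differentiable zeta :
  `|zeta| < Defs.rad C ^+ 2 -> differentiable (fnf C mu) zeta.
Proof.
move=> zr; apply/derivable1_diffP.
apply: (@derivable_slice _ _ _ (fnf C)); exact: (smooth_derivable (spf_fnf_smooth hC)).
Qed.

Lemma poincare_differentiable w :
  cube (Defs.rad C) w -> differentiable (poincare C mu) w.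
Proof.
move=> /cube_prod wr.
have d0 : differentiable (fun y : 'rV[R]_2 => y 0 0) w by exact: differentiable_coord.
have d1 : differentiable (fun y : 'rV[R]_2 => y 0 1) w by exact: differentiable_coord.
have df : differentiable (fun y : 'rV[R]_2 => fnf C mu (y 0 0 * y 0 1)) w.
  apply: (@differentiable_comp _ _ _ _ (fun y : 'rV[R]_2 => y 0 0 * y 0 1) (fnf C mu)).
    exact: differentiableM.
  exact: fnf_differentiable.
apply: differentiable_vec2; last exact: differentiableM.
apply: differentiableM => //; apply: differentiableV => //.
by rewrite gt_eqF// (spf_fnf_pos hC).
Qed.

Lemma poincare_dom_open : open (poincare_dom C mu).
Proof.
rewrite openE => w [wr pw]; rewrite /interior.
have pc := differentiable_continuous (poincare_differentiable wr).
have h1 : \forall z \near w, cube (Defs.rad C) z.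
  by apply: open_nbhs_nbhs; split => //; exact: cube_open.
have h2 : \forall z \near w, cube (Defs.rad C) (poincare C mu z).
  by apply: pc; apply: open_nbhs_nbhs; split => //; exact: cube_open.
by near=> z; split; near: z.
Unshelve. all: by end_near. Qed.

(** The product [u v] is invariant under the Poincare map, so each iteration
    multiplies by the same factor. *)
Lemma iter_poincare n (w : 'rV[R]_2) (f := fnf C mu (w 0 0 * w 0 1)) : f != 0 ->
  iter n (poincare C mu) w = vec2 (w 0 0 / f ^+ n) (w 0 1 * f ^+ n).
Proof.
move=> f0; elim: n => [|n IHn]; first by rewrite /= expr0 divr1 mulr1 vec2_eta.
rewrite iterS IHn /poincare !vec2_0 !vec2_1.
have -> : w 0 0 / f ^+ n * (w 0 1 * f ^+ n) = w 0 0 * w 0 1.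
  by field; rewrite expf_neq0.
by rewrite -/f !exprSr invfM !mulrA.
Qed.

End Poincare.

(** * The global map along a symmetric homoclinic orbit *)

Lemma weighted_sum_bound (R : realType) (x y b X Y : R) :
  `|x| <= b -> `|y| <= b -> `|x * X + y * Y| <= b * (`|X| + `|Y|).
Proof.
move=> xb yb; apply: le_trans (ler_normD _ _) _; rewrite !normrM mulrDr.
by apply: lerD; apply: ler_wpM2r.
Qed.

Section Connection.
Variables (R : realType) (M : symplectic4 R) (F : ham_family M)
  (P : saddle_center_data M) (D : disk_data R) (C : periodic_data M)
  (K : connection_data M) (ty : connection_type).
Hypotheses (hF : reversible_family F) (hP : saddle_center_family F P ty)
  (hD : disk_family F P D) (hC : saddle_periodic_family F P C)
  (hK : heteroclinic_connection F P D C K).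

Variable g : R -> 'rV[R]_2 -> 'rV[R]_2.
Let im := [set z : R * 'rV[R]_2 |
  `|z.1| < mu_max F /\ (T2 K z.1 @` cube (delta D)) z.2].
Hypotheses (im_open : open im) (g_smooth : smooth_on im (fun z => g z.1 z.2))
  (gK : forall m w, `|m| < mu_max F -> cube (delta D) w -> g m (T2 K m w) = w).

Lemma delta_gt0 : 0 < delta D.
Proof. by case: hD => _ /andP[]. Qed.

Lemma D2_flip mu w : invol F (D2 F P D mu w) = D1 P D mu (flip w).
Proof. by case: hF => _ [_ LL _ _] _ _; rewrite /D2 LL. Qed.

Lemma T2_differentiable mu w : `|mu| < mu_max F -> cube (delta D) w ->
  differentiable (T2 K mu) w.
Proof.
by move=> mm wd; exact: (analytic_map_differentiable (hc_T2_analytic hK mm) wd).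
Qed.

Lemma g_differentiable mu y : `|mu| < mu_max F ->
  (T2 K mu @` cube (delta D)) y -> differentiable (g mu) y.
Proof. by move=> mm Ty; exact: (smooth_slice_differentiable im_open g_smooth). Qed.

Lemma im_near mu y : `|mu| < mu_max F -> (T2 K mu @` cube (delta D)) y ->
  \forall z \near y, (T2 K mu @` cube (delta D)) z.
Proof.
move=> mm Ty.
have : \forall z \near y, im (mu, z).
  have : {for y, continuous (fun z => (mu, z))} by exact: slice_continuous.
  by apply; apply: open_nbhs_nbhs; split => //; split.
by apply: filterS => z [].
Qed.

Variables (mu : R) (n : nat).
Hypothesis mm : `|mu| < mu_max F.

(** From the second disk along the unstable separatrix to the section, [n] times
    around the periodic orbit, and back to the first disk: the last passage is
    the mirror image of the first one, run backwards. *)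
Definition global_map (w : 'rV[R]_2) : 'rV[R]_2 :=
  flip (g mu (swap (iter n (poincare C mu) (T2 K mu w)))).

Let a := T2 K mu 0 0 0.
Let v := T2 K mu 0 0 1.
Let phi := fnf C mu (a * v).

Hypotheses (rate_neg : xi_rate P mu < 0) (v_gt0 : 0 < v) (phi_lt1 : phi < 1)
  (root : a = v * phi ^+ n).

Let T0 : cube (delta D) (0 : 'rV[R]_2).
Proof. exact/cube0/delta_gt0. Qed.

Let Tr : cube (Defs.rad C) (T2 K mu 0).
Proof. exact: (hc_T2_range hK). Qed.

Lemma phi_gt0 : 0 < phi.
Proof. by apply: (spf_fnf_pos hC) => //; exact: cube_prod. Qed.

(** Along the iteration the first coordinate grows from [a] to [v] and the second
    one decreases from [v] to [a], so the domain of the section is never left. *)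
Lemma orbit_in_cube k : (k <= n)%N ->
  cube (Defs.rad C) (iter k (poincare C mu) (T2 K mu 0)).
Proof.
move=> kn; rewrite iter_poincare ?gt_eqF ?phi_gt0// -/a -/v -/phi => i.
have vr : v < Defs.rad C by apply: le_lt_trans (Tr 1); exact: ler_norm.
have p0 := phi_gt0; have p1 := ltW phi_lt1.
have pk0 m : 0 < phi ^+ m by rewrite exprn_gt0.
have pk1 m : phi ^+ m <= 1 by rewrite exprn_ile1// ltW.
apply: le_lt_trans vr.
rewrite mxE; case: i => [[|[|]]] //= _; rewrite ger0_norm.
- rewrite root -mulrA; apply: ler_piMr; first exact: ltW.
  by rewrite -(subnK kn) exprD mulfK ?gt_eqF.
- by apply: divr_ge0; rewrite ltW// root mulr_gt0.
- by apply: ler_piMr => //; exact: ltW.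
- by rewrite mulr_ge0// ltW.
Qed.

(** The equation [a = v phi ^ n] says that [n] iterations carry [(a, v)] to its
    mirror image [(v, a)], which is the trace of the stable separatrix. *)
Lemma swap_orbit : swap (iter n (poincare C mu) (T2 K mu 0)) = T2 K mu 0.
Proof.
have pn0 : phi ^+ n != 0 by rewrite gt_eqF// exprn_gt0// phi_gt0.
rewrite iter_poincare ?gt_eqF ?phi_gt0// -/a -/v -/phi.
apply: row2P; rewrite /swap !mxE /= -/a -/v; first by rewrite root.
by rewrite root mulfK.
Qed.

Lemma iter_differentiable k : (k <= n)%N ->
  differentiable (fun w => iter k (poincare C mu) (T2 K mu w)) 0.
Proof.
elim: k => [|k IHk] kn; first exact: T2_differentiable.
apply: (@differentiable_comp _ _ _ _
  (fun w => iter k (poincare C mu) (T2 K mu w)) (poincare C mu)).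
  exact/IHk/ltnW.
by apply: (poincare_differentiable hC mm); apply: orbit_in_cube; exact: ltnW.
Qed.

Let imT0 : (T2 K mu @` cube (delta D)) (T2 K mu 0).
Proof. by exists 0. Qed.

Lemma global_map_differentiable : differentiable global_map 0.
Proof.
pose Sn w := iter n (poincare C mu) (T2 K mu w).
apply: (@differentiable_comp _ _ _ _ (fun w => g mu (swap (Sn w))) (@flip R)).
  apply: (@differentiable_comp _ _ _ _ (fun w => swap (Sn w)) (g mu)).
    apply: (@differentiable_comp _ _ _ _ Sn (@swap R)).
      exact: iter_differentiable.
    exact: differentiable_swap.
  by apply: g_differentiable => //; rewrite /Sn swap_orbit.
exact: differentiable_flip.
Qed.

(** All the passages exist in a neighbourhood of the origin of the second disk,
    hence on a small square; over the origin they form the middle part of the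
    homoclinic orbit, whose two ends are the separatrices. *)
Lemma general_type_of_root : ~ rotation_mx (jacobian global_map 0) ->
  exists x, general_type_homoclinic F P D mu x.
Proof.
move=> nrot; have [mmax [La LL Lc _] _ hH] := hF.
have Ha := (hH _ mm).1; have HL := (hH _ mm).2.
have fT := hc_T2_flow hK mm; have fS := spf_poincare hC mm.
have Tc w : cube (delta D) w -> {for w, continuous (T2 K mu)}.
  by move=> wd; exact/differentiable_continuous/T2_differentiable.
have Sc w : poincare_dom C mu w -> {for w, continuous (poincare C mu)}.
  by case=> wr _; exact/differentiable_continuous/(poincare_differentiable hC mm).
have [tn fn] := flow_map_iter fT fS Tc Sc n.
pose A := iter_dom (cube (delta D)) (poincare_dom C mu) (T2 K mu) (poincare C mu) n.
have Ac w : A w -> {for w, continuous (fun w => iter n (poincare C mu) (T2 K mu w))}.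
  exact: iter_continuous.
pose B := [set y | (T2 K mu @` cube (delta D)) (swap y)].
(* the mirror image of the passage from the second disk to the section *)
have fR : flow_map (ham F mu) B (sig C mu) (D1 P D mu) (fun y => flip (g mu (swap y)))
    (fun y => tau2 K mu (g mu (swap y))).
  apply: (flow_map_reversed Ha La Lc HL fT (L := invol F)) => //.
  - by move=> w wd; exact: gK.
  - by move=> y Ty; exact/differentiable_continuous/g_differentiable.
  - by move=> y; exact/differentiable_continuous/differentiable_swap.
  - move=> y [w wd we]; have yr : cube (Defs.rad C) (swap y).
      by rewrite -we; exact: (hc_T2_range hK).
    by rewrite (spf_invol hC mm yr) -[vec2 _ _]/(swap (swap y)) swapK.
  - by move=> w _; exact: D2_flip.
pose Adom : set 'rV[R]_2 := [set w | A w /\ B (iter n (poincare C mu) (T2 K mu w))].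
have fG : flow_map (ham F mu) Adom (D2 F P D mu) (D1 P D mu) global_map
    (fun w => tn w + tau2 K mu (g mu (swap (iter n (poincare C mu) (T2 K mu w))))).
  apply: (@flow_map_comp _ _ _ Adom B _ _ _
    (fun w => iter n (poincare C mu) (T2 K mu w)) (fun y => flip (g mu (swap y)))
    tn (fun y => tau2 K mu (g mu (swap y)))).
  - by move=> w [Aw _]; exact: fn.
  - exact: fR.
  - by move=> w [_ Bw]; exact: Bw.
  - by move=> w [Aw _]; exact: Ac.
have A0 : \forall w \near (0 : 'rV[R]_2), A w.
  apply: (iter_dom_near Tc Sc) => //.
    by apply: open_nbhs_nbhs; split => //; exact: cube_open.
  move=> k kn; split; last exact: (poincare_dom_open hC mm).
  split; first by apply: orbit_in_cube; exact: ltnW.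
  exact: (orbit_in_cube kn).
have Adom0 : \forall w \near (0 : 'rV[R]_2), Adom w.
  have c0 : {for 0, continuous (fun w => swap (iter n (poincare C mu) (T2 K mu w)))}.
    apply: (@continuous_comp _ _ _
      (fun w => iter n (poincare C mu) (T2 K mu w)) (@swap R)).
      exact: Ac (nbhs_singleton A0).
    exact/differentiable_continuous/differentiable_swap.
  have B0 : \forall w \near (0 : 'rV[R]_2), B (iter n (poincare C mu) (T2 K mu w)).
    by apply: c0; rewrite /= swap_orbit; exact: im_near.
  by near=> w; split; near: w.
have [e /= e0 eA] := (nbhs_ballP _ _).1 Adom0.
pose r := Num.min e (delta D).
have r0 : 0 < r by rewrite lt_min e0 delta_gt0.
have rA w : cube r w -> Adom w.
  move=> wr; apply: eA; split => // i j; rewrite (ord1 i) /ball /= mxE sub0r normrN.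
  by apply: lt_le_trans (wr j) _; rewrite ge_min lexx.
have [t0 _ fl] := fG 0 (rA 0 (cube0 r0)).
pose tau := fun w => tn w + tau2 K mu (g mu (swap (iter n (poincare C mu) (T2 K mu w)))).
have G0 : global_map 0 = 0 by rewrite /global_map swap_orbit gK// flip0.
have [u [su up u0 unp]] := unstable_separatrix hF hP hD mm rate_neg.
have D2L : invol F (D2 F P D mu 0) = D1 P D mu 0 by rewrite D2_flip flip0.
have flu : flows (ham F mu) (u 0) (tau 0) (invol F (u 0)).
  by move: fl; rewrite G0 u0 D2L.
have [x [hx x0 xt]] :=
  symmetric_homoclinic Ha La Lc HL su up (pmu_symmetric hP mm) unp t0 flu.
exists x; split; first exact: hx.
exists 0, (tau 0); split.
- exact: t0.
- by rewrite x0 u0.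
- by rewrite xt u0 D2L.
exists r, global_map, tau; split.
- by rewrite r0 ge_min lexx orbT.
- by move=> w /rA; exact: fG.
- move=> w /rA[_ [w' w'd /= e']].
  by rewrite /global_map -e' gK//; exact: cube_flip.
- by rewrite subr0.
- by split=> //; exact: global_map_differentiable.
Unshelve. all: by end_near. Qed.

Lemma is_derive_coord (k : nat) (h : R -> 'rV[R]_k) (t : R) X j :
  is_derive t (1 : R) h X -> is_derive t (1 : R) (fun s => h s 0 j) (X 0 j).
Proof.
move=> [dh <-]; rewrite derive_mx// mxE; apply: DeriveDef => //.
by move/derivable_mxP: dh; apply.
Qed.

Let w := 'D_(delta_mx 0 0) (g mu) (T2 K mu 0).
Let psi := 'D_1 (fnf C mu) (a * v).

(** The inverse of the passage map, along the line through the trace of the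
    separatrix in the expanding direction of the Poincare map. *)
Lemma is_derive_inverse_line :
  is_derive (0 : R) (1 : R) (fun s => g mu (T2 K mu 0 + s *: delta_mx 0 0)) w.
Proof.
have := @is_derive_line _ _ _ (g mu) (T2 K mu 0) (delta_mx 0 0) 0.
rewrite scale0r addr0; apply.
exact/diff_derivable/g_differentiable.
Qed.

(** Differentiating [u / f(u v) ^ n] in [u]: the factor [phi ^ (- n)] is the
    expansion, and the correction carries the small factor [n a v]. *)
Lemma is_derive_expanded :
  is_derive (0 : R) (1 : R) (fun s => (a + s) / fnf C mu ((a + s) * v) ^+ n)
    ((1 - n%:R * (a * v) * psi / phi) / phi ^+ n).
Proof.
have p0 := phi_gt0.
have das : is_derive (0 : R) (1 : R) (fun s => a + s) 1.
  by rewrite -[X in is_derive _ _ _ X]add0r; apply: is_deriveD.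
have dav : is_derive (0 : R) (1 : R) (fun s => (a + s) * v) v.
  have -> : (fun s => (a + s) * v) = v *: (fun s => a + s).
    by apply/funext => s; rewrite mulrC.
  by rewrite -[X in is_derive _ _ _ X]mulr1; exact: is_deriveZ.
have dp : is_derive (0 : R) (1 : R) (fun s => fnf C mu ((a + s) * v)) (psi * v).
  apply: (@is_derive1_comp _ (fnf C mu) (fun s => (a + s) * v)) => //.
  rewrite addr0; apply: DeriveDef => //.
  exact/derivable1_diffP/(fnf_differentiable hC mm)/cube_prod.
have p0E : fnf C mu ((a + 0) * v) = phi by rewrite addr0.
have dpn : is_derive (0 : R) (1 : R) (fun s => fnf C mu ((a + s) * v) ^+ n)
    (n%:R * phi ^+ n / phi * (psi * v)).
  case: (n) => [|k].
    rewrite !mul0r; exact: is_derive_cst.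
  have -> : (fun s => fnf C mu ((a + s) * v) ^+ k.+1) =
      (fun s => fnf C mu ((a + s) * v)) ^+ k.+1.
    by rewrite exprfctE.
  have -> : k.+1%:R * phi ^+ k.+1 / phi * (psi * v) =
      (k.+1%:R * phi ^+ k) *: (psi * v).
    by rewrite exprSr mulrA mulfK ?gt_eqF.
  rewrite -p0E; exact: is_deriveX.
have pn0 : fnf C mu ((a + 0) * v) ^+ n != 0 by rewrite p0E gt_eqF// exprn_gt0.
have dV := @is_deriveV _ (fun s => fnf C mu ((a + s) * v) ^+ n) 0 _ 1 pn0 dpn.
have := is_deriveM das dV.
set X := (X in is_derive _ _ _ X); set Y := (X in _ -> is_derive _ _ _ X).
suff -> : X = Y by [].
rewrite /X /Y !p0E addr0 /=.
rewrite -![_ *: _]/(_ * _).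
have phi0 : phi != 0 by rewrite gt_eqF.
by field; rewrite phi0 ?expf_neq0.
Qed.

(** Undoing the last passage of [global_map] and using that [swap] exchanges the
    coordinates, one reads off the expanding coordinate after [n] iterations. *)
Lemma expanded_coordinate : \forall s \near (0 : R),
  T2 K mu (flip (global_map (g mu (T2 K mu 0 + s *: delta_mx 0 0)))) 0 1 =
  (a + s) / fnf C mu ((a + s) * v) ^+ n.
Proof.
pose c s := g mu (T2 K mu 0 + s *: delta_mx 0 0).
have cc : {for 0, continuous c} := is_derive_continuous is_derive_inverse_line.
have c0 : c 0 = 0 by rewrite /c scale0r addr0 gK.
have line_c : {for 0, continuous (fun s : R => T2 K mu 0 + s *: delta_mx 0 0)}.
  by apply: cvgD; [exact: cvg_cst|exact: scalel_continuous].
have near1 : \forall s \near (0 : R),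
    (T2 K mu @` cube (delta D)) (T2 K mu 0 + s *: delta_mx 0 0).
  by apply: line_c; rewrite scale0r addr0; exact: im_near.
have near_r : \forall s \near (0 : R),
    cube (Defs.rad C) (T2 K mu 0 + s *: delta_mx 0 0).
  apply: line_c; rewrite scale0r addr0; apply: open_nbhs_nbhs.
  by split => //; exact: cube_open.
have near2 : \forall s \near (0 : R),
    (T2 K mu @` cube (delta D)) (swap (iter n (poincare C mu) (T2 K mu (c s)))).
  have : {for 0, continuous ((fun w => swap (iter n (poincare C mu) (T2 K mu w))) \o c)}.
    apply: continuous_comp => //; rewrite c0.
    apply: (@continuous_comp _ _ _
      (fun w => iter n (poincare C mu) (T2 K mu w)) (@swap R)).
      exact/differentiable_continuous/iter_differentiable.
    exact/differentiable_continuous/differentiable_swap.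
  by apply; rewrite /= c0 swap_orbit; exact: im_near.
near=> s.
(* the first passage undoes the inverse in c *)
have e1 : T2 K mu (c s) = T2 K mu 0 + s *: delta_mx 0 0.
  have [w' w'd we] : (T2 K mu @` cube (delta D)) (T2 K mu 0 + s *: delta_mx 0 0).
    by near: s.
  by rewrite /c -we gK.
have [w' w'd we] : (T2 K mu @` cube (delta D))
    (swap (iter n (poincare C mu) (T2 K mu (c s)))).
  by near: s.
rewrite /global_map flipK -/(c s) -we gK// we e1 /swap vec2_1.
have y0 : (T2 K mu 0 + s *: delta_mx 0 0) 0 0 = a + s by rewrite !mxE /= mulr1.
have y1 : (T2 K mu 0 + s *: delta_mx 0 0) 0 1 = v by rewrite !mxE /= mulr0 addr0.
rewrite iter_poincare; first by rewrite vec2_0 y0 y1.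
rewrite gt_eqF// (spf_fnf_pos hC)//; apply: cube_prod; near: s; exact: near_r.
Unshelve. all: by end_near. Qed.

(** Differentiating [expanded_coordinate] at 0 relates the expansion to the
    differential of [global_map]. Were the latter a rotation, the expansion would
    be bounded by first derivatives of the passage map and of its inverse, which
    do not depend on [n]. *)
Lemma rotation_bound : rotation_mx (jacobian global_map 0) ->
  `|(1 - n%:R * (a * v) * psi / phi) / phi ^+ n| <=
  (`|w 0 0| + `|w 0 1|) *
  (`|'D_(delta_mx 0 0) (T2 K mu) 0 0 1| + `|'D_(delta_mx 0 1) (T2 K mu) 0 0 1|).
Proof.
move=> [th Jth].
pose c s := g mu (T2 K mu 0 + s *: delta_mx 0 0).
have c0 : c 0 = 0 by rewrite /c scale0r addr0 gK.
have G0 : global_map 0 = 0 by rewrite /global_map swap_orbit gK// flip0.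
have dc : is_derive (0 : R) (1 : R) c w := is_derive_inverse_line.
have dGc : is_derive (0 : R) (1 : R) (global_map \o c) (w *m jacobian global_map 0).
  rewrite -c0; apply: is_derive_map => //; rewrite c0; exact: global_map_differentiable.
pose z := flip (w *m jacobian global_map 0).
have dfl : is_derive (0 : R) (1 : R) (@flip R \o (global_map \o c)) z.
  rewrite /z -(diff_flip ((global_map \o c) 0)); apply: is_derive_comp => //.
  exact: differentiable_flip.
have dT2 : differentiable (T2 K mu) 0 by exact: T2_differentiable.
have dT : is_derive (0 : R) (1 : R) (T2 K mu \o (@flip R \o (global_map \o c)))
    ('d (T2 K mu) 0 z).
  have := @is_derive_comp _ _ _ (T2 K mu) _ 0 _ _ dfl.
  by rewrite /= c0 G0 flip0; apply.
have dq := near_eq_is_derive expanded_coordinate (is_derive_coord 1 dT).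
have <- : ('d (T2 K mu) 0 z) 0 1 = (1 - n%:R * (a * v) * psi / phi) / phi ^+ n.
  rewrite -(@derive_val _ _ _ _ _ _ _ dq).
  by rewrite (@derive_val _ _ _ _ _ _ _ is_derive_expanded).
have -> : 'd (T2 K mu) 0 z = z 0 0 *: 'D_(delta_mx 0 0) (T2 K mu) 0 +
    z 0 1 *: 'D_(delta_mx 0 1) (T2 K mu) 0.
  rewrite {1}(row_sum_delta z) 2!big_ord_recl big_ord0 addr0 linearD !linearZ /=.
  rewrite !deriveE//.
  have -> : lift ord0 ord0 = 1 :> 'I_2 by exact/val_inj.
  by [].
(* the entries of a rotation matrix are at most 1, and flip changes signs only *)
have zb j : `|z 0 j| <= `|w 0 0| + `|w 0 1|.
  have J1 i k : `|jacobian global_map 0 i k| <= 1.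
    rewrite Jth mxE; case: ifP => _; first by rewrite ler_norml cos_geN1 cos_le1.
    by case: ifP => _; rewrite ?normrN ler_norml sin_geN1 sin_le1.
  have wJ k : `|(w *m jacobian global_map 0) 0 k| <= `|w 0 0| + `|w 0 1|.
    rewrite mxE 2!big_ord_recl big_ord0 addr0.
    apply: le_trans (ler_normD _ _) _; rewrite !normrM.
    apply: lerD; first by rewrite ler_piMr.
    rewrite (_ : lift ord0 ord0 = 1); last exact/val_inj.
    by rewrite ler_piMr.
  by rewrite /z mxE; case: j => [[|[|]]] //= j2; rewrite ?normrN.
have lin (x y : R) (X Y : 'rV[R]_2) : (x *: X + y *: Y) 0 1 = x * X 0 1 + y * Y 0 1.
  by rewrite !mxE.
rewrite lin; exact: weighted_sum_bound.
Qed.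

End Connection.

(** * The expansion dominates every constant *)

Section Limits.
Variable R : realType.

(** With [q = r ^ 2], the numbers [n r ^ n] are bounded by the sum of the geometric
    series of ratio [r], and one more factor [r ^ n] tends to 0. *)
Lemma cvg_natmul_exprn (q : R) : 0 < q < 1 -> (n%:R * q ^+ n) @[n --> \oo] --> (0 : R).
Proof.
move=> /andP[q0 q1]; pose r := Num.sqrt q.
have r0 : 0 < r by rewrite sqrtr_gt0.
have rr : q = r ^+ 2 by rewrite sqr_sqrtr// ltW.
have r1 : r < 1 by rewrite -(@expr_lt1 _ 2) ?ltW// -rr.
have nr n : n%:R * r ^+ n <= (1 - r)^-1.
  have le_sum : n%:R * r ^+ n <= \sum_(i < n) r ^+ i.
    rewrite -{1}(card_ord n) mulr_natl -sumr_const; apply: ler_sum => i _.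
    by apply: ler_wiXn2l; [exact: ltW|exact: ltW|exact: ltnW].
  rewrite -div1r ler_pdivlMr ?subr_gt0//.
  apply: le_trans (_ : (\sum_(i < n) r ^+ i) * (1 - r) <= _).
    by rewrite ler_wpM2r// subr_ge0 ltW.
  rewrite mulrC -opprB mulNr -subrX1 opprB gerBl exprn_ge0// ltW//.
have gr : (geometric (1 - r)^-1 r) @ \oo --> (0 : R).
  by apply: cvg_geometric; rewrite ger0_norm// ltW.
apply: (squeeze_cvgr _ (@cvg_cst _ _ _ _ _) gr) => //.
apply: nearW => n; rewrite mulr_ge0 ?exprn_ge0 ?(ltW q0)//=.
rewrite rr exprAC expr2 mulrA ler_wpM2r ?exprn_ge0// ltW//.
Qed.

(** At a root [a = v phi ^ n] the correction in the expansion is of the order of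
    [n q ^ n], while [phi ^ (- n)] exceeds [q ^ (- n)]. *)
Lemma blowup_ineq (n : nat) (v phi psi q q0 rd B1 B2 : R) :
  0 < v < rd -> 0 < q0 < phi -> phi < q -> `|psi| <= B1 -> 0 <= B2 ->
  n%:R * q ^+ n * (rd ^+ 2 * B1 / q0) <= 2^-1 -> B2 * q ^+ n < 2^-1 ->
  B2 < `|(1 - n%:R * (v * phi ^+ n * v) * psi / phi) / phi ^+ n|.
Proof.
move=> /andP[v0 vr] /andP[q00 q0p] pq psiB B20 h1 h2.
have phi0 : 0 < phi by exact: lt_trans q0p.
have pn0 : 0 < phi ^+ n by rewrite exprn_gt0.
have pqn : phi ^+ n <= q ^+ n by rewrite lerXn2r ?nnegrE ?ltW// (lt_trans phi0).
have qn0 : 0 <= q ^+ n by apply: le_trans pqn; rewrite ltW.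
have B10 : 0 <= B1 by apply: le_trans psiB.
set e := n%:R * _ * _ / _.
have eb : `|e| <= 2^-1.
  apply: le_trans h1.
  have -> : `|e| = n%:R * phi ^+ n * (v ^+ 2 * `|psi| / phi).
    rewrite /e !normrM normfV normr_nat !(gtr0_norm v0) (gtr0_norm pn0).
    rewrite (gtr0_norm phi0).
    by field; rewrite gt_eqF.
  apply: ler_pM.
  - by rewrite mulr_ge0// ltW.
  - by rewrite divr_ge0 ?mulr_ge0 ?exprn_ge0// ltW.
  - by rewrite ler_wpM2l.
  apply: ler_pM.
  - by rewrite mulr_ge0 ?exprn_ge0// ltW.
  - by rewrite invr_ge0 ltW.
  - by apply: ler_pM => //; rewrite ?exprn_ge0 ?lerXn2r ?nnegrE ?ltW// (lt_trans v0).
  - by rewrite lef_pV2 ?posrE// ltW.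
rewrite normrM normfV (gtr0_norm pn0) ltr_pdivlMr//.
apply: le_lt_trans (_ : B2 * q ^+ n < _); first by rewrite ler_wpM2l.
apply: lt_le_trans h2 _.
have := lerB_dist 1 e; rewrite normr1; lra.
Qed.

End Limits.

(** * Roots of the homoclinic equation *)

Section Final.
Variables (R : realType) (M : symplectic4 R) (F : ham_family M)
  (P : saddle_center_data M) (D : disk_data R) (C : periodic_data M)
  (K : connection_data M) (ty : connection_type).
Hypotheses (hF : reversible_family F) (hP : saddle_center_family F P ty)
  (hD : disk_family F P D) (hC : saddle_periodic_family F P C)
  (hK : heteroclinic_connection F P D C K).

Let d0 : 0 < delta D. Proof. exact: delta_gt0 hD. Qed.
Let m0 : 0 < mu_max F. Proof. by case: hF. Qed.
Let mm0 : `|0 : R| < mu_max F. Proof. by rewrite normr0. Qed.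

Let a m := T2 K m 0 0 0.
Let v m := T2 K m 0 0 1.
Let phi m := fnf C m (a m * v m).
Let psi m := 'D_1 (fnf C m) (a m * v m).

Let T2_smooth : smooth_on [set z : R * 'rV[R]_2 | `|z.1| < mu_max F /\ cube (delta D) z.2]
   (fun z => T2 K z.1 z.2).
Proof. by case: (hc_T2_diffeo hK). Qed.

Lemma trace_continuous m : `|m| < mu_max F -> {for m, continuous (fun m => T2 K m 0)}.
Proof.
move=> mm; apply: (slice_value_continuous (x := fun=> 0) T2_smooth); last exact: cvg_cst.
by split => //=; exact: cube0.
Qed.

Lemma a_continuous m : `|m| < mu_max F -> {for m, continuous a}.
Proof.
move=> mm.
apply: (@continuous_comp _ _ _ (fun m => T2 K m 0) (fun w : 'rV[R]_2 => w 0 0)).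
  exact: trace_continuous.
exact: coord_continuous.
Qed.

Lemma v_continuous m : `|m| < mu_max F -> {for m, continuous v}.
Proof.
move=> mm.
apply: (@continuous_comp _ _ _ (fun m => T2 K m 0) (fun w : 'rV[R]_2 => w 0 1)).
  exact: trace_continuous.
exact: coord_continuous.
Qed.

Lemma zeta_continuous m : `|m| < mu_max F -> {for m, continuous (fun m => a m * v m)}.
Proof. by move=> mm; exact: (continuousM (a_continuous mm) (v_continuous mm)). Qed.

Let zeta_dom m : `|m| < mu_max F ->
  [set z : R * R | `|z.1| < mu_max F /\ `|z.2| < Defs.rad C ^+ 2] (m, a m * v m).
Proof.
move=> mm; split => //=; apply: cube_prod.
by apply: (hc_T2_range hK) => //; exact: cube0.
Qed.

Lemma phi_continuous m : `|m| < mu_max F -> {for m, continuous phi}.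
Proof.
move=> mm; apply: (slice_value_continuous (spf_fnf_smooth hC) (zeta_dom mm)).
exact: zeta_continuous.
Qed.

Lemma psi_continuous m : `|m| < mu_max F -> {for m, continuous psi}.
Proof.
move=> mm; apply: (slice_derive_continuous (spf_fnf_smooth hC) (zeta_dom mm)).
exact: zeta_continuous.
Qed.

Lemma T2_partial_continuous i : {for (0 : R),
  continuous (fun m => 'D_(delta_mx 0 i) (T2 K m) 0 : 'rV[R]_2)}.
Proof.
apply: (slice_derive_continuous (x := fun=> 0) T2_smooth); last exact: cvg_cst.
by split => //=; exact: cube0.
Qed.

Lemma trace_v_at0 : v 0 = vplus K.
Proof. by rewrite /v (hc_T2_base hK) vec2_1. Qed.

Lemma trace_a_at0 : a 0 = 0.
Proof. by rewrite /a (hc_T2_base hK) vec2_0. Qed.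

Lemma v_lt_rad m : `|m| < mu_max F -> v m < Defs.rad C.
Proof.
move=> mm; have : cube (Defs.rad C) (T2 K m 0).
  by apply: (hc_T2_range hK) => //; exact: cube0.
by move=> /(_ 1); apply: le_lt_trans; exact: ler_norm.
Qed.

(** The sign of the parameter is that of the derivative of [a], for which [a] is
    positive; this is the common sign of all the parameter values found. *)
Lemma a_crosses : generic_family K ->
  exists s : R, (s = 1 \/ s = -1) /\ \forall t \near (0 : R)^'+, 0 < a (s * t).
Proof.
rewrite /generic_family derive1E -[a_coord K]/a => al0.
have da : derivable a 0 1.
  have U0 : [set z : R * 'rV[R]_2 | `|z.1| < mu_max F /\ cube (delta D) z.2] (0, 0).
    by split => //=; exact: cube0.
  have := smooth_derivable (v := ((1, 0) : R * 'rV[R]_2)) T2_smooth U0.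
  move=> /derivable_mxP/(_ 0 0); rewrite /derivable.
  rewrite (_ : (fun h => _) = (fun h : R => h^-1 *: ((a \o shift 0) (h *: 1) - a 0)))//.
  by apply/funext => h /=; rewrite scaler0 !addr0.
set al := 'D_1 a 0 in al0.
have /is_derive_cvgP ca : is_derive (0 : R) (1 : R) a al by exact: derivableP.
pose s := Num.sg al; exists s; split.
  by rewrite /s; case: sgrP al0 => // _ _; [left|right].
have sal : 0 < s * al by rewrite /s -normrEsg normr_gt0.
have ss : s * s = 1 by rewrite /s -expr2 sqr_sg al0.
have : \forall h \near (0 : R)^', 0 < s * (h^-1 *: (a (h *: 1 + 0) - a 0)).
  have cs : s * (h^-1 *: (a (h *: 1 + 0) - a 0)) @[h --> 0^'] --> s * al.
    by apply: cvgM => //; exact: cvg_cst.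
  exact: (cvgr_gt _ cs).
move=> /nbhs_ballP[e /= e0 eH].
near=> t.
have t0 : 0 < t by near: t; exact: nbhs_right_gt.
have : 0 < s * ((s * t)^-1 *: (a ((s * t) *: 1 + 0) - a 0)).
  have sn : `|s| = 1 by rewrite /s normr_sg al0.
  apply: eH; rewrite /ball /= ?sub0r ?normrN ?normrM ?sn ?mul1r.
    rewrite ger0_norm ?ltW//; near: t; exact: nbhs_right_lt.
  apply: mulf_neq0; last by rewrite gt_eqF.
  by rewrite -normr_eq0 sn oner_eq0.
have si : s^-1 = s by rewrite -[LHS]mulr1 -ss mulKf// -normr_eq0 /s normr_sg al0 oner_eq0.
rewrite trace_a_at0 subr0 addr0 [_ *: 1]mulr1 -[_ *: _]/(_ * _).
rewrite invfM si !mulrA ss mul1r.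
by rewrite pmulr_rgt0// invr_gt0.
Unshelve. all: by end_near. Qed.

(** The function [a - v phi ^ n] is negative at the parameter value 0, where [a]
    vanishes, and positive at a fixed small value when [n] is large, because
    [phi] stays below some [q < 1]; the intermediate value theorem gives a root.
    The bounds on a neighbourhood of 0 are chosen before [n], so that [n] can be
    taken large enough for the expansion to exclude a rotation. *)
Lemma general_type_near : generic_family K ->
  exists s : R, (s = 1 \/ s = -1) /\
    forall e, 0 < e -> exists t, [/\ 0 < t < e, `|s * t| < mu_max F &
      exists x, general_type_homoclinic F P D (s * t) x].
Proof.
move=> gen; have [s [s1 a_pos]] := a_crosses gen.
exists s; split => // e e0.
have [_ im_open [g [g_smooth gK']]] := hc_T2_diffeo hK.
have gK m w : `|m| < mu_max F -> cube (delta D) w -> g m (T2 K m w) = w.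
  by move=> mm wd; exact: (gK' (m, w)).
have sn : `|s| = 1 by case: s1 => ->; rewrite ?normrN normr1.
pose w m := 'D_(delta_mx 0 0) (g m) (T2 K m 0).
pose W m := (`|w m 0 0| + `|w m 0 1|) *
  (`|'D_(delta_mx 0 0) (T2 K m) 0 0 1| + `|'D_(delta_mx 0 1) (T2 K m) 0 0 1|).
have w_cont : {for (0 : R), continuous w}.
  apply: (slice_derive_continuous g_smooth); last exact: trace_continuous.
  by split => //=; exists 0 => //; exact: cube0.
have coord_cont (h : R -> 'rV[R]_2) j : {for (0 : R), continuous h} ->
    {for (0 : R), continuous (fun m => `|h m 0 j|)}.
  move=> hc; apply: (@continuous_comp _ _ _ (fun m => h m 0 j) (fun y : R => `|y|)).
    apply: (@continuous_comp _ _ _ h (fun y : 'rV[R]_2 => y 0 j)) => //.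
    exact: coord_continuous.
  exact: norm_continuous.
have W_cont : {for (0 : R), continuous W}.
  apply: continuousM.
    by apply: continuousD; exact: coord_cont.
  by apply: continuousD; apply: coord_cont; exact: T2_partial_continuous.
have near_lt (h : R -> R) c : {for (0 : R), continuous h} -> h 0 < c ->
    \forall m \near (0 : R), h m < c.
  by move=> hc h0; apply: (cvgr_lt _ hc).
have near_gt (h : R -> R) c : {for (0 : R), continuous h} -> c < h 0 ->
    \forall m \near (0 : R), c < h m.
  by move=> hc h0; apply: (cvgr_gt _ hc).
have phi0E : phi 0 = multiplier C 0 by rewrite /phi trace_a_at0 mul0r.
have [/andP[phi00 phi01] _ _] := spf_saddle hC mm0.
rewrite -phi0E in phi00 phi01.
(* at the parameter value 0, phi is the multiplier of the periodic orbit *)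
pose q := (1 + phi 0) / 2; pose q0 := phi 0 / 2.
have pq : phi 0 < q by rewrite /q; lra.
have q1 : q < 1 by rewrite /q; lra.
have q0p : 0 < q0 < phi 0 by rewrite /q0; lra.
have [q0_gt0 q0_lt] := andP q0p.
have q_gt0 : 0 < q by exact: lt_trans pq.
pose B1 := `|psi 0| + 1; pose B2 := W 0 + 1.
have v00 : 0 < v 0 by rewrite trace_v_at0; case/andP: (hc_vplus hK).
have goodnear : \forall m \near (0 : R), [/\ `|m| < mu_max F, xi_rate P m < 0,
    0 < v m & [/\ phi m < q, q0 < phi m, `|psi m| < B1 & W m < B2]].
  have n1 : \forall m \near (0 : R), `|m| < mu_max F by exact: nbhs0_lt.
  have n2 := xi_rate_near hF hP.
  have n3 := near_gt _ _ (v_continuous mm0) v00.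
  have n4 := near_lt _ _ (phi_continuous mm0) pq.
  have n5 := near_gt _ _ (phi_continuous mm0) q0_lt.
  have n6 : \forall m \near (0 : R), `|psi m| < B1.
    apply: (near_lt (fun m => `|psi m|)); last by rewrite /B1 ltrDl.
    apply: (@continuous_comp _ _ _ psi (fun y : R => `|y|)); last exact: norm_continuous.
    exact: psi_continuous.
  have n7 : \forall m \near (0 : R), W m < B2.
    by apply: near_lt => //; rewrite /B2 ltrDl.
  near=> m; split; [by near: m|by near: m|by near: m|].
  by split; near: m.
have [d /= d_gt0 dH] := (nbhs_ballP _ _).1 goodnear.
have good t : 0 <= t < d -> `|s * t| < d.
  by move=> /andP[t0 td]; rewrite normrM sn mul1r ger0_norm.
have {}dH t : 0 <= t < d -> [/\ `|s * t| < mu_max F, xi_rate P (s * t) < 0,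
    0 < v (s * t) & [/\ phi (s * t) < q, q0 < phi (s * t),
      `|psi (s * t)| < B1 & W (s * t) < B2]].
  by move=> /good td; apply: dH; rewrite /ball /= sub0r normrN.
have [t1 [t10 t1d t1e at1]] : exists t1, [/\ 0 < t1, t1 < d, t1 < e & 0 < a (s * t1)].
  suff : \forall t \near (0 : R)^'+, [/\ 0 < t, t < d, t < e & 0 < a (s * t)].
    by move=> /filter_ex[t ht]; exists t.
  near=> t; split; near: t => //;
    [exact: nbhs_right_gt|exact: nbhs_right_lt|exact: nbhs_right_lt].
pose rd := Defs.rad C.
have rd0 : 0 < rd := spf_rad hC.
have q01 : 0 < q < 1 by rewrite q_gt0.
have cq : q ^+ n @[n --> \oo] --> (0 : R).
  by apply: cvg_expr; rewrite ger0_norm// ltW.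
have small_seq (u : nat -> R) (c b : R) : u n @[n --> \oo] --> (0 : R) -> 0 < b ->
    \forall n \near \oo, c * u n < b.
  move=> uc b0; apply: (cvgr_lt (c * 0)); last by rewrite mulr0.
  by apply: cvgM => //; exact: cvg_cst.
(* the third condition makes a - v phi ^ n positive at t1, the first two feed
   blowup_ineq *)
have [n [nA nB nC]] : exists n : nat,
    [/\ rd ^+ 2 * B1 / q0 * (n%:R * q ^+ n) < 2^-1, B2 * q ^+ n < 2^-1 &
        rd * q ^+ n < a (s * t1)].
  suff : \forall n \near \oo,
    [/\ rd ^+ 2 * B1 / q0 * (n%:R * q ^+ n) < 2^-1, B2 * q ^+ n < 2^-1 &
        rd * q ^+ n < a (s * t1)].
    by move=> /filter_ex[n hn]; exists n.
  have s1' := small_seq _ (rd ^+ 2 * B1 / q0) 2^-1 (cvg_natmul_exprn q01).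
  have s2' := small_seq _ B2 2^-1 cq.
  have s3' := small_seq _ rd _ cq at1.
  have half0 : 0 < 2^-1 :> R by rewrite invr_gt0.
  near=> n; split; near: n; [exact: s1'|exact: s2'|exact: s3'].
pose Phi t := a (s * t) - v (s * t) * phi (s * t) ^+ n.
have Phi_cont : {within `[0, t1], continuous Phi}.
  apply: continuous_in_subspaceT => t; rewrite inE /= in_itv /= => /andP[t0 tt1].
  have td : 0 <= t < d by rewrite t0 (le_lt_trans tt1).
  have [mm _ _ _] := dH t td.
  have sc : {for t, continuous (fun t => s * t)}.
    by apply: cvgM; [exact: cvg_cst|exact: cvg_id].
  have ca : {for t, continuous (fun t => a (s * t))}.
    apply: (@continuous_comp _ _ _ (fun t => s * t) a) => //; exact: a_continuous.
  have cv : {for t, continuous (fun t => v (s * t))}.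
    apply: (@continuous_comp _ _ _ (fun t => s * t) v) => //; exact: v_continuous.
  have cp : {for t, continuous (fun t => phi (s * t) ^+ n)}.
    apply: (@continuous_comp _ _ _ (fun t => phi (s * t)) (fun y => y ^+ n)).
      apply: (@continuous_comp _ _ _ (fun t => s * t) phi) => //; exact: phi_continuous.
    exact: exprn_continuous.
  exact: (continuousB ca (continuousM cv cp)).
have Phi0 : Phi 0 < 0.
  by rewrite /Phi mulr0 trace_a_at0 sub0r oppr_lt0 mulr_gt0// exprn_gt0.
have Phi1 : 0 < Phi t1.
  have t1' : 0 <= t1 < d by rewrite ltW.
  have [mm _ vm [pm1 pm2 _ _]] := dH _ t1'.
  rewrite /Phi subr_gt0; apply: le_lt_trans nC.
  have p0 : 0 <= phi (s * t1) by rewrite ltW// (lt_trans q0_gt0).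
  apply: ler_pM; [exact: ltW|exact: exprn_ge0|exact/ltW/v_lt_rad|].
  by rewrite lerXn2r ?nnegrE// ltW.
have [t] : exists2 t, t \in `[0, t1] & Phi t = 0.
  apply: IVT => //; first exact: ltW.
  by rewrite ge_min le_max (ltW Phi0) (ltW Phi1) orbT.
rewrite in_itv /= => /andP[t0 tt1] Phit.
have tn0 : 0 < t.
  rewrite lt_neqAle t0 andbT; apply/eqP => te.
  by move: Phi0; rewrite [X in Phi X]te Phit ltxx.
have td : 0 <= t < d by rewrite t0 (le_lt_trans tt1).
have [mm rate vm [pm1 pm2 psim Wm]] := dH _ td.
have root : a (s * t) = v (s * t) * phi (s * t) ^+ n.
  by apply/eqP; rewrite -subr_eq0; exact/eqP.
exists t; split => //; first by rewrite tn0 (le_lt_trans tt1).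
have phi_lt1 : phi (s * t) < 1 by exact: lt_trans q1.
apply: (general_type_of_root hF hP hD hC hK im_open g_smooth gK mm rate vm phi_lt1 root).
move=> rot.
have := rotation_bound hD hC hK im_open g_smooth gK mm vm phi_lt1 root rot.
apply/negP; rewrite -ltNge; apply: lt_trans Wm _.
rewrite -/(a (s * t)) -/(v (s * t)) -/(phi (s * t)) -/(psi (s * t)) {1}root.
apply: (@blowup_ineq _ _ _ _ _ q q0 rd B1 B2) => //.
- by rewrite vm v_lt_rad.
- by rewrite q0_gt0.
- exact: ltW.
- by rewrite /B2 addr_ge0// mulr_ge0// addr_ge0.
- by rewrite mulrC ltW.
Unshelve. all: by end_near. Qed.

End Final.

Unset Implicit Arguments.

Theorem theorem11 (R : realType) (M : symplectic4 R) (F : ham_family M)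
    (P : saddle_center_data M) (D : disk_data R) (C : periodic_data M)
    (K : connection_data M) (ty : connection_type) :
  reversible_family F ->
  saddle_center_family F P ty ->
  disk_family F P D ->
  saddle_periodic_family F P C ->
  heteroclinic_connection F P D C K ->
  generic_family K ->
  exists mu_ : nat -> R,
    [/\ mu_ n @[n --> \oo] --> (0 : R),
        forall n, `|mu_ n| < mu_max F,
        (forall n, 0 < mu_ n) \/ (forall n, mu_ n < 0) &
        forall n, exists x : R -> M,
          general_type_homoclinic F P D (mu_ n) x].
Proof.
move=> hF hP hD hC hK gen.
have [s [s1 sH]] := general_type_near hF hP hD hC hK gen.
have /choice[t tH] : forall n : nat, exists t : R, [/\ 0 < t < n.+1%:R^-1,
    `|s * t| < mu_max F & exists x, general_type_homoclinic F P D (s * t) x].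
  by move=> n; apply: sH; rewrite invr_gt0.
have t_cvg : t n @[n --> \oo] --> (0 : R).
  apply: (squeeze_cvgr _ (@cvg_cst _ _ _ _ _) (@cvg_harmonic R)) => //.
  by apply: nearW => n; have [/andP[t0 tn] _ _] := tH n; rewrite !ltW.
exists (fun n => s * t n); split.
- rewrite -[X in _ --> X](mulr0 s); apply: cvgM => //; exact: cvg_cst.
- by move=> n; have [] := tH n.
- case: s1 => ->; [left|right] => n; have [/andP[t0 _] _ _] := tH n.
    by rewrite mul1r.
  by rewrite mulN1r oppr_lt0.
- by move=> n; have [] := tH n.
Qed.
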